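(* Let $\Delta$ be a positive integer and $a$ the largest integer such that $2^a$ divides $\Delta$. The following codes form a complete and non-redundant list of the isomorphism types of binary indecomposable full-length $\Delta$-divisible linear codes of dimension $k\ge1$ that are spanned by codewords of weight $\Delta$: (i) $\frac{\Delta}{2^{k-1}}\cdot\mathrm{Sim}_2(k)$ with $1\le k\le a+1$; (ii) $\frac{\Delta}{2^{k-2}}\cdot\mathrm{RM}_2(k)$ with $3\le k\le a+2$; (iii) $\frac{\Delta}{2}\cdot\mathrm{PC}_2(k)$ with $a\ge1$ and $k\ge4$.
   Context: Binary linear codes are subspaces of $\mathbb{F}_2^n$; weight is the number of nonzero coordinates; $\Delta$-divisible means all codeword weights are divisible by $\Delta$. Full-length: no coordinate is zero in all codewords. Indecomposable: there are no nonzero subcodes $D,D'$ with $D+D'=C$ and disjoint supports (support of a subcode = coordinates where some codeword of it is nonzero). Binary codes are isomorphic if they have the same length and differ by a coordinate permutation. The $m$-fold repetition $m\cdot C$ repeats every coordinate $m$ times. $\mathrm{Sim}_2(k)$ is the code generated by the matrix whose columns are all nonzero vectors of $\mathbb{F}_2^k$. $\mathrm{RM}_2(k)$ ($k\ge2$) is the code generated by the $k\times 2^{k-1}$ matrix whose columns are all vectors of $\mathbb{F}_2^{k-1}$, extended by an all-one row. $\mathrm{PC}_2(k)=\{c\in\mathbb{F}_2^{k+1}\mid c_1+\cdots+c_{k+1}=0\}$. *)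

(* Defs.v *)
From HB Require Import structures.
From mathcomp Require Import all_boot all_order all_fingroup all_algebra.
Set Implicit Arguments. Unset Strict Implicit. Unset Printing Implicit Defensive.
Import GRing.Theory.
Local Open Scope ring_scope.

Notation code n := {vspace 'rV['F_2]_n}.

Definition weight n (c : 'rV['F_2]_n) : nat := #|[set i | c 0 i != 0]|.

Definition code_support n (C : code n) : {set 'I_n} :=
  [set i | [exists c : 'rV['F_2]_n, (c \in C) && (c 0 i != 0)]].

Definition divisible_code (Delta n : nat) (C : code n) : Prop :=
  forall c, c \in C -> (Delta %| weight c)%N.

Definition full_length n (C : code n) : Prop :=
  forall i : 'I_n, exists2 c, c \in C & c 0 i != 0.

Definition indecomposable n (C : code n) : Prop :=
  ~ exists D D' : code n,
      [/\ D != 0%VS, D' != 0%VS, (D + D')%VS = C &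
          [disjoint code_support D & code_support D']].

Definition spanned_by_weight (Delta n : nat) (C : code n) : Prop :=
  <<[seq c <- enum {: 'rV['F_2]_n} | (c \in C) && (weight c == Delta)]>>%VS = C.

(* The lengths n and m need not be syntactically equal, hence the cast. *)
Definition code_iso n m (C : code n) (D : code m) : Prop :=
  exists (e : n = m) (s : 'S_m), forall c : 'rV['F_2]_n,
    (c \in C) = (col_perm s (castmx (erefl 1%N, e) c) \in D).

Definition generated_code k n (G : 'M['F_2]_(k, n)) : code n :=
  <<[seq row i G | i <- enum 'I_k]>>%VS.

(* const_mx 1 *m c is the m x n matrix all of whose rows are c; mxvec
   concatenates these rows. *)
Definition repetition (m n : nat) (C : code n) : code (m * n) :=
  (linfun (mxvec \o mulmx (const_mx 1 : 'cV['F_2]_m)) @: C)%VS.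

Lemma mem_repetition m n (C : code n) (v : 'rV_(m * n)) :
  reflect (exists2 c, c \in C & forall i j, v 0 (mxvec_index i j) = c 0 j)
          (v \in repetition m C).
Proof.
apply: (iffP memv_imgP) => -[c cC cv]; exists c => //.
  move=> i j; rewrite cv lfunE /= mxvecE mxE big_ord1.
  by rewrite !mxE mul1r.
apply/rowP => x; case/mxvec_indexP: x => i j.
by rewrite cv lfunE /= mxvecE mxE big_ord1 !mxE mul1r.
Qed.

Definition Sim_matrix (k : nat) :
    'M['F_2]_(k, #|[set v : 'cV['F_2]_k | v != 0]|) :=
  \matrix_(i, j) (enum_val j : 'cV_k) i 0.

Definition Sim (k : nat) := generated_code (Sim_matrix k).

(* Meaningful for k >= 2: there are k.-1 + 1 = k rows. *)
Definition RM_matrix (k : nat) :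
    'M['F_2]_(k.-1 + 1, #|{: 'cV['F_2]_k.-1}|) :=
  col_mx (\matrix_(i, j) (enum_val j : 'cV_k.-1) i 0) (const_mx 1).

Definition RM (k : nat) := generated_code (RM_matrix k).

Definition PC (k : nat) : code k.+1 :=
  lker (linfun (mulmxr (const_mx 1 : 'cV['F_2]_k.+1) : 'rV_k.+1 -> 'M_1)).

Lemma mem_PC k (c : 'rV_k.+1) : (c \in PC k) = (\sum_i c 0 i == 0).
Proof.
have E : (c *m const_mx 1 : 'M_1) 0 0 = \sum_i c 0 i.
  by rewrite mxE; apply: eq_bigr => i _; rewrite mxE mulr1.
rewrite memv_ker lfunE /= -E; apply/eqP/eqP => [->|h]; first by rewrite mxE.
by apply/matrixP => i j; rewrite !ord1 h mxE.
Qed.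

Variant code_family := Simplex | ReedMuller | ParityCheck.

Definition in_list (a : nat) (f : code_family) (k : nat) : bool :=
  match f with
  | Simplex => (1 <= k <= a + 1)%N
  | ReedMuller => (3 <= k <= a + 2)%N
  | ParityCheck => (1 <= a)%N && (4 <= k)%N
  end.

(* The truncated divisions and subtractions are exact whenever in_list a f k
   holds and 2 ^ a divides Delta. *)
Definition listed_length (Delta : nat) (f : code_family) (k : nat) : nat :=
  match f with
  | Simplex => (Delta %/ 2 ^ (k - 1) * #|[set v : 'cV['F_2]_k | v != 0%R]|)%N
  | ReedMuller => (Delta %/ 2 ^ (k - 2) * #|{: 'cV['F_2]_k.-1}|)%N
  | ParityCheck => (Delta %/ 2 * k.+1)%N
  end.

Definition listed_code (Delta : nat) (f : code_family) (k : nat) :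
    code (listed_length Delta f k) :=
  match f with
  | Simplex => repetition (Delta %/ 2 ^ (k - 1))%N (Sim k)
  | ReedMuller => repetition (Delta %/ 2 ^ (k - 2))%N (RM k)
  | ParityCheck => repetition (Delta %/ 2)%N (PC k)
  end.

Definition classified_code (Delta k n : nat) (C : code n) : Prop :=
  [/\ \dim C = k, indecomposable C, full_length C,
      divisible_code Delta C & spanned_by_weight Delta C].

(* Main.v *)
Require Import Defs.
From HB Require Import structures.
From mathcomp Require Import all_boot all_order all_fingroup all_algebra zify.
Set Implicit Arguments. Unset Strict Implicit. Unset Printing Implicit Defensive.

(** Describe a code by the multiplicities of the columns of a generator matrix.
    Two distinct words of weight Delta in a Delta-divisible code have overlap 0
    or Delta/2.  If the code is spanned by such words and indecomposable, it is
    built up one weight-Delta word at a time, each new word c meeting the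
    support of the previous code; so it suffices to see how a listed code can be
    extended.  For a column value x, let f x be the number of columns equal to x
    on which c is 1.  The sums of f over the complements of hyperplanes are
    overlaps, hence 0 or Delta/2.
    - Over a simplex code: if no sum vanishes, f is constant by inversion of the
      Radon transform, giving the next simplex code; if the sum at u0 vanishes,
      then comparing f with its bound forces f to be maximal on all of
      the hyperplane u0, giving a Reed-Muller code.
    - Over a Reed-Muller code: either f is constant on the affine space, giving
      the next Reed-Muller code, or f lives on one point, which forces dimension
      3 and gives a parity check code.
    - Over a parity check code of dimension at least 4, f lives on one point.
    Dimension and length tell the listed codes apart: the lengths are smaller
    than, equal to and larger than 2 Delta in the three families. *)

Section Classification.
Import GRing.Theory.
Local Open Scope ring_scope.

(** * Linear functionals over F_2 *)

Lemma F2_neq0D (a b : 'F_2) : (a + b != 0) = (a != 0) (+) (b != 0).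
Proof. by move: a b; do 2!case=> [[|[|//]] ?]. Qed.

Lemma F2_neq0 (a : 'F_2) : a != 0 -> a = 1.
Proof. by case: a => [[|[|//]] ?] // _; apply: val_inj. Qed.

Lemma F2_addvv m n (A : 'M['F_2]_(m, n)) : A + A = 0.
Proof. by apply/matrixP => i j; rewrite !mxE; case: (A i j) => [[|[|//]] ?]; apply: val_inj. Qed.

Lemma F2_oppv m n (A : 'M['F_2]_(m, n)) : - A = A.
Proof. by apply/eqP; rewrite eq_sym -addr_eq0 F2_addvv. Qed.

Lemma F2_addv_eq0 m n (A B : 'M['F_2]_(m, n)) : (A + B == 0) = (A == B).
Proof. by rewrite addr_eq0 F2_oppv. Qed.

Lemma mx11_neq0 (a : 'M['F_2]_1) : (a != 0) = (a 0 0 != 0).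
Proof.
by congr (~~ _); apply/eqP/eqP => [->|e]; [rewrite mxE | apply/matrixP => ??; rewrite !ord1 e mxE].
Qed.

Lemma mx11_eq1 (a : 'M['F_2]_1) : a != 0 -> a = 1.
Proof. by rewrite mx11_neq0 => /F2_neq0 e; apply/matrixP => ??; rewrite !ord1 e mxE. Qed.

(** Boolean-valued, so that [dot u] can serve directly as the predicate of a sum, with [(+)]
    expressing linearity. *)
Definition dot k (u : 'rV['F_2]_k) (x : 'cV['F_2]_k) : bool := (u *m x) 0 0 != 0.

Lemma dotDl k (u v : 'rV_k) (x : 'cV_k) : dot (u + v) x = dot u x (+) dot v x.
Proof. by rewrite /dot mulmxDl mxE F2_neq0D. Qed.
Lemma dotDr k (u : 'rV_k) (x y : 'cV_k) : dot u (x + y) = dot u x (+) dot u y.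
Proof. by rewrite /dot mulmxDr mxE F2_neq0D. Qed.
Lemma dot0x k (x : 'cV_k) : dot 0 x = false.
Proof. by rewrite /dot mul0mx mxE eqxx. Qed.
Lemma dotx0 k (u : 'rV_k) : dot u 0 = false.
Proof. by rewrite /dot mulmx0 mxE eqxx. Qed.
Lemma dot_tr k (u : 'rV_k) (x : 'cV_k) : dot x^T u^T = dot u x.
Proof. by rewrite /dot -trmx_mul mxE. Qed.

Lemma dot_col k n (u : 'rV_k) (G : 'M_(k, n)) j : dot u (col j G) = ((u *m G) 0 j != 0).
Proof. by rewrite /dot !mxE; under eq_bigr do rewrite mxE. Qed.

Lemma dot_block k (a b : 'M_1) (u : 'rV_k) (x : 'cV_k) :
  dot (row_mx a u) (col_mx b x) = (a != 0) && (b != 0) (+) dot u x.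
Proof.
rewrite /dot mul_row_col mxE F2_neq0D [in X in X (+) _]mxE big_ord1 mulf_eq0 negb_or.
by rewrite -!mx11_neq0.
Qed.

Lemma dot_separate_zero k (x : 'cV['F_2]_k) : x != 0 -> exists u, dot u x.
Proof.
move=> /eqP x0; have [i xi] : exists i, x i 0 != 0.
  apply/existsP; apply: contra_notT x0 => /existsPn x0.
  by apply/colP => i; rewrite mxE; apply/eqP; rewrite -[_ == _]negbK x0.
exists (delta_mx 0 i); rewrite /dot -rowE !mxE //.
Qed.

(** If [a] is 1 at both points, take [b] with value 1 at [x + y], so that [b] differs at [x] and
    [y]; then [b] or [a + b] separates them in the required order. *)
Lemma dot_separate k (x y : 'cV['F_2]_k) : x != 0 -> x != y ->
  exists u, dot u x /\ dot u y = false.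
Proof.
move=> /dot_separate_zero[a ax] xy.
case ay: (dot a y); last by exists a.
have /dot_separate_zero[b] : x + y != 0 by rewrite F2_addv_eq0.
rewrite dotDr; case by0: (dot b y); rewrite ?addbT ?addbF => bx; last by exists b.
by exists (a + b); rewrite !dotDl (negPf bx) ax ay by0.
Qed.

Lemma dot_separate_row k (u v : 'rV['F_2]_k) : u != 0 -> u != v ->
  exists x, dot u x /\ dot v x = false.
Proof.
move=> u0 uv; have [||x []] := @dot_separate k u^T v^T.
- by rewrite -(inj_eq trmx_inj) trmxK trmx0.
- by rewrite (inj_eq trmx_inj).
by exists x^T; rewrite -!(dot_tr _ x^T) !trmxK.
Qed.

Lemma dot_separate_row_zero k (u : 'rV['F_2]_k) : u != 0 -> exists x, dot u x.
Proof. by move=> u0; have [x []] := dot_separate_row u0 u0; exists x. Qed.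

Lemma dot_common k (x y : 'cV['F_2]_k) : x != 0 -> y != 0 ->
  exists u, dot u x /\ dot u y.
Proof.
move=> x0 y0; have [<-|xy] := eqVneq x y.
  by have [u] := dot_separate_zero x0; exists u.
have [u [ux uy]] := dot_separate x0 xy.
have [|v [vy vx]] := dot_separate y0 (y := x); first by rewrite eq_sym.
by exists (u + v); rewrite !dotDl ux uy vy vx.
Qed.

(** Translation by [t] preserves [Q] and exchanges the two halves cut out by [h]. *)
Lemma card_half (V : finZmodType) (t : V) (Q h : pred V) :
  (forall x, Q (x + t) = Q x) -> (forall x, h (x + t) = ~~ h x) ->
  (2 * #|[pred x | Q x && h x]| = #|[pred x | Q x]|)%N.
Proof.
move=> Qt ht; rewrite -[in RHS](cardID h) mul2n -addnn; congr (_ + _)%N.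
rewrite -!sum1_card (reindex_inj (addIr t)) /=.
by apply: eq_bigl => x; rewrite !inE Qt ht andbC.
Qed.

Lemma card_cV2 k : #|{: 'cV['F_2]_k}| = (2 ^ k)%N.
Proof. by rewrite card_mx muln1 card_ord. Qed.
Lemma card_rV2 k : #|{: 'rV['F_2]_k}| = (2 ^ k)%N.
Proof. by rewrite card_mx mul1n card_ord. Qed.

Lemma card_dot_col k (u : 'rV['F_2]_k) : u != 0 ->
  (2 * #|[pred x | dot u x]| = 2 ^ k)%N.
Proof.
move=> u0; have [t ut] := dot_separate_row_zero u0.
rewrite -card_cV2 -(@card_half _ t predT (fun x => dot u x)) //.
by move=> x; rewrite dotDr ut addbT.
Qed.

Lemma card_dot_row k (x : 'cV['F_2]_k) : x != 0 ->
  (2 * #|[pred u | dot u x]| = 2 ^ k)%N.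
Proof.
move=> /dot_separate_zero[t tx].
rewrite -card_rV2 -(@card_half _ t predT (fun u => dot u x)) //.
by move=> u; rewrite dotDl tx addbT.
Qed.

Lemma card_dot_col2 k (u v : 'rV['F_2]_k) b : u != 0 -> v != 0 -> u != v ->
  (4 * #|[pred x | ((dot u x) == b) && (dot v x)]| = 2 ^ k)%N.
Proof.
move=> u0 v0 uv; have [t [vt ut]] : exists x, dot v x /\ dot u x = false.
  by apply: dot_separate_row; rewrite // eq_sym.
rewrite -[4%N]/(2 * 2)%N -mulnA (@card_half _ t (fun x => (dot u x) == b)).
- have [s us] := dot_separate_row_zero u0.
  rewrite -card_cV2 -(@card_half _ s predT (fun x => (dot u x) == b)) //.
  by move=> x; rewrite dotDr us addbT; case: (dot u x); case: b.
- by move=> x; rewrite dotDr ut addbF.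
- by move=> x; rewrite dotDr vt addbT.
Qed.

Lemma card_dot_row2 k (x y : 'cV['F_2]_k) : x != 0 -> y != 0 -> x != y ->
  (4 * #|[pred u | (dot u x) && (dot u y)]| = 2 ^ k)%N.
Proof.
move=> x0 y0 xy; have [t [yt xt]] : exists u, dot u y /\ dot u x = false.
  by apply: dot_separate; rewrite // eq_sym.
rewrite -[4%N]/(2 * 2)%N -mulnA (@card_half _ t (fun u => dot u x)).
- exact: card_dot_row.
- by move=> u; rewrite dotDl xt addbF.
- by move=> u; rewrite dotDl yt addbT.
Qed.

(* Inversion of the Radon transform u |-> \sum_(x | dot u x) g x. *)
Lemma radon_inversion k (g : 'cV['F_2]_k -> nat) x0 : x0 != 0 ->
  (4 * (\sum_(u | dot u x0) \sum_(x | dot u x) g x)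
   = 2 ^ k * (g x0 + \sum_(x | x != 0%R) g x))%N.
Proof.
move=> x00; rewrite (exchange_big_dep predT) //= big_distrr /=.
(* After the exchange, [g x] is counted once for each [u] that is 1 at both [x0] and [x]: 2^(k-1)
   times for [x = x0], 2^(k-2) times for any other nonzero [x], never for [x = 0]. *)
have -> : (\sum_x 4 * \sum_(u | (dot u x0) && (dot u x)) g x
   = \sum_(x | x != 0%R) 2 ^ k * ((x == x0) + 1) * g x)%N.
  rewrite [RHS]big_mkcond; apply: eq_bigr => x _.
  rewrite sum_nat_const; have [->|x0' /=] := eqVneq x 0.
    rewrite eq_card0 ?muln0 // => u; by rewrite unfold_in dotx0 andbF.
  have [->|xx0] := eqVneq x x0.
    rewrite -(card_dot_row x00) mulnA; congr (_ * _)%N.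
    have -> : #|[pred u | (dot u x0) && (dot u x0)]| =
              #|[pred u | dot u x0]| by apply: eq_card => u; rewrite !inE andbb.
    by lia.
  by rewrite mulnA muln1 (card_dot_row2 x00 x0') // eq_sym.
rewrite (bigD1 x0) //= [in RHS](bigD1 x0) //= eqxx.
rewrite (eq_bigr (fun x => 2 ^ k * g x)%N) => [|x /andP[_ /negPf ->]]; last by rewrite muln1.
rewrite -big_distrr /=; set S := (\sum_(x | _) g x)%N.
by rewrite !mulnDr muln1 mulnDl addnA.
Qed.

(** * Column multiplicities, weights and overlaps *)

Definition mult k n (G : 'M['F_2]_(k, n)) (x : 'cV['F_2]_k) : nat :=
  #|[set j | col j G == x]|.

Definition mult_on k n (G : 'M['F_2]_(k, n)) (c : 'rV['F_2]_n) x : nat :=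
  #|[set j | (col j G == x) && (c 0 j != 0)]|.

Definition overlap n (c d : 'rV['F_2]_n) : nat :=
  #|[set j | (c 0 j != 0) && (d 0 j != 0)]|.

Lemma card_fibres (I J : finType) (h : I -> J) (P : pred J) (Q : pred I) :
  #|[set i | P (h i) && Q i]| = (\sum_(y | P y) #|[set i | (h i == y) && Q i]|)%N.
Proof.
rewrite -sum1_card (partition_big h P) /=; last by move=> i; rewrite inE => /andP[].
apply: eq_bigr => y Py; rewrite -sum1_card; apply: eq_bigl => i; rewrite !inE.
by have [->|] := eqVneq (h i) y; rewrite ?Py ?andbT ?andbF.
Qed.

Lemma mult_on_le k n (G : 'M_(k, n)) c x : (mult_on G c x <= mult G x)%N.
Proof. by apply: subset_leq_card; apply/subsetP => j; rewrite !inE => /andP[]. Qed.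

Lemma weight_mulmx k n (G : 'M_(k, n)) u :
  weight (u *m G) = (\sum_(x | dot u x) mult G x)%N.
Proof.
have := card_fibres (fun j => col j G) (fun x => dot u x) predT.
under eq_bigr do [under eq_finset do rewrite andbT].
by move<-; apply: eq_card => j; rewrite !inE dot_col andbT.
Qed.

Lemma overlap_mulmx k n (G : 'M_(k, n)) c u :
  overlap c (u *m G) = (\sum_(x | dot u x) mult_on G c x)%N.
Proof.
rewrite -(card_fibres (fun j => col j G) (fun x => dot u x) (fun j => c 0 j != 0)).
by apply: eq_card => j; rewrite !inE dot_col andbC.
Qed.

Lemma weight_mult_on k n (G : 'M_(k, n)) c :
  weight c = (\sum_x mult_on G c x)%N.
Proof.
rewrite -(card_fibres (fun j => col j G) predT (fun j => c 0 j != 0)).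
by apply: eq_card => j; rewrite !inE.
Qed.

Lemma weightD n (c d : 'rV['F_2]_n) :
  (weight (c + d) + 2 * overlap c d = weight c + weight d)%N.
Proof.
rewrite /weight /overlap -!sum1_card.
rewrite !(big_mkcond (fun i => i \in _)) /= big_distrr -!big_split /=.
apply: eq_bigr => j _; rewrite !inE mxE F2_neq0D.
by case: (c 0 j != 0); case: (d 0 j != 0).
Qed.

Lemma weight_eq0 n (c : 'rV['F_2]_n) : (weight c == 0%N) = (c == 0).
Proof.
rewrite cards_eq0; apply/eqP/eqP => [/setP c0|->]; last by apply/setP=> i; rewrite !inE mxE eqxx.
by apply/rowP => i; have := c0 i; rewrite !inE mxE => /negbFE/eqP.
Qed.

(** The weight of [c + d] is 2 Delta minus twice the overlap; being a nonzero multiple of Delta, it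
    is Delta or 2 Delta. *)
Lemma overlap_weight Delta n (c d : 'rV['F_2]_n) : (0 < Delta)%N ->
  weight c = Delta -> weight d = Delta -> c != d -> (Delta %| weight (c + d))%N ->
  (2 * overlap c d = 0 \/ 2 * overlap c d = Delta)%N.
Proof.
move=> D0 wc wd cd /dvdnP[q qE]; have := weightD c d; rewrite wc wd.
have : weight (c + d) != 0%N by rewrite weight_eq0 F2_addv_eq0.
rewrite qE; case: q qE => [|[|[|q]]] qE; rewrite ?mulSn ?mul0n; lia.
Qed.

Lemma mult_block1 k n (G : 'M_(k, n)) c (b : 'M_1) x : b != 0 ->
  mult (col_mx c G) (col_mx b x) = mult_on G c x.
Proof.
move=> b0; apply: eq_card => j; rewrite !inE col_col_mx.
rewrite (mx11_eq1 b0).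
have -> : (c 0 j != 0) = (col j c == 1).
  apply/idP/eqP => [/F2_neq0 e|/matrixP/(_ 0 0)]; last by rewrite !mxE => ->.
  by apply/matrixP => ??; rewrite !ord1 !mxE e.
apply/eqP/andP => [/eq_col_mx[-> ->]//|[/eqP-> /eqP->]//].
Qed.

(** Columns with top entry 0 are those off the support of [c]. The additive form avoids truncated
    subtraction. *)
Lemma mult_block0 k n (G : 'M_(k, n)) c x :
  (mult (col_mx c G) (col_mx 0 x) + mult_on G c x = mult G x)%N.
Proof.
rewrite /mult -(cardsID [set j | c 0 j == 0] [set j | col j G == x]).
congr (_ + _)%N; apply: eq_card => j; rewrite !inE; last by rewrite andbC.
have -> : (c 0 j == 0) = (col j c == 0).
  apply/eqP/eqP => [e|/matrixP/(_ 0 0)]; last by rewrite !mxE.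
  by apply/matrixP => ??; rewrite !ord1 !mxE e.
rewrite col_col_mx; apply/eqP/andP => [/eq_col_mx[-> ->]//|[/eqP-> /eqP->]//].
Qed.

Lemma mul_row_col_F2 k n (G : 'M['F_2]_(k, n)) c (a : 'M_1) u :
  row_mx a u *m col_mx c G = (if a != 0 then c else 0) + u *m G.
Proof.
rewrite mul_row_col; congr (_ + _).
have [->|a0] := eqVneq a 0; first by rewrite mul0mx.
by rewrite (mx11_eq1 a0) mul1mx.
Qed.

(** * Extending a code by one word *)

(* The equation says m = Delta / 2 ^ (k - 1) without truncated operations; likewise
   m = Delta / 2 ^ (k - 2) in rm_type. *)
Definition sim_type Delta k n (G : 'M['F_2]_(k, n)) : Prop :=
  exists2 m, (m * 2 ^ k = 2 * Delta)%N & forall x, x != 0 -> mult G x = m.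

Definition rm_type Delta k n (G : 'M['F_2]_(k, n)) : Prop :=
  exists m u0, [/\ (2 < k)%N, u0 != 0, (m * 2 ^ k = 4 * Delta)%N
    & forall x, x != 0 -> mult G x = (m * dot u0 x)%N].

(* P consists of k + 1 points in general position: up to a base change, the unit
   vectors and their sum. *)
Definition pc_type Delta k n (G : 'M['F_2]_(k, n)) : Prop :=
  exists P : {set 'cV['F_2]_k},
    [/\ (3 < k)%N, #|P| = k.+1, 0 \notin P, \sum_(p in P) p = 0
      & forall x, x != 0 -> (2 * mult G x = Delta * (x \in P))%N].

(** The last condition says that [c] meets the support of the code generated by [G]. The value of
    [mult_on G c] at 0 counts the coordinates of [c] outside that support. *)
Definition extension Delta k n (G : 'M['F_2]_(k, n)) (c : 'rV['F_2]_n) : Prop :=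
  [/\ weight c = Delta, forall u, c != u *m G,
      forall u, (Delta %| weight (c + u *m G))%N
    & exists2 x, x != 0 & (0 < mult_on G c x)%N].

Lemma extension_overlap Delta k n (G : 'M_(k, n)) c u : (0 < Delta)%N ->
  extension Delta G c -> weight (u *m G) = Delta ->
  let F := (\sum_(x | dot u x) mult_on G c x)%N in
  (2 * F = 0 \/ 2 * F = Delta)%N.
Proof.
move=> D0 [wc nc dc _] wu /=; rewrite -overlap_mulmx.
exact: overlap_weight.
Qed.

(** Prepending [c] splits the columns equal to [x] according to their top entry, so a guess [g] for
    the new multiplicities is checked separately on top entries 1 and 0. *)
Lemma mult_col_mx k n (G : 'M_(k, n)) c (g : 'cV_(1 + k) -> nat) :
  (forall x, mult_on G c x = g (col_mx 1 x)) ->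
  (forall x, x != 0 -> mult G x = (g (col_mx 0%R x) + mult_on G c x)%N) ->
  forall y, y != 0 -> mult (col_mx c G) y = g y.
Proof.
move=> g1 g0 y; rewrite -[y]vsubmxK; move: (usubmx y) (dsubmx y) => b x.
have [->|b0] := eqVneq b 0; last by rewrite mult_block1 // (mx11_eq1 b0) g1.
rewrite col_mx_eq0 eqxx /= => /g0; rewrite -(mult_block0 G c).
by move/addIn.
Qed.

Lemma sum_mult_on_neq0 Delta k n (G : 'M_(k, n)) c : extension Delta G c ->
  (mult_on G c 0%R + \sum_(x | x != 0%R) mult_on G c x = Delta)%N.
Proof. by case=> <- _ _ _; rewrite (weight_mult_on G c) [RHS](bigD1 0). Qed.

Lemma card_neq0_cV k : (#|[pred x : 'cV['F_2]_k | x != 0%R]| + 1 = 2 ^ k)%N.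
Proof.
rewrite -card_cV2 [RHS](cardD1 (0 : 'cV['F_2]_k)) inE [LHS]addnC; congr (_ + _)%N.
by apply: eq_card => x; rewrite !inE andbT.
Qed.

Lemma sum_eq_bound (T : finType) (P : pred T) (f : T -> nat) m x : P x ->
  (forall y, P y -> f y <= m)%N ->
  (\sum_(y | P y) f y = \sum_(y | P y) m)%N -> f x = m.
Proof.
move=> Px fm; have := fm x Px; rewrite (bigD1 x) //= [in RHS](bigD1 x) //=.
have : (\sum_(y | P y && (y != x)) f y <= \sum_(y | P y && (y != x)) m)%N.
  by apply: leq_sum => y /andP[/fm].
lia.
Qed.

Lemma sum_dot_col k (u : 'rV['F_2]_k) m : u != 0 ->
  (2 * \sum_(x | dot u x) m = m * 2 ^ k)%N.
Proof. by move=> u0; rewrite sum_nat_const mulnA card_dot_col // mulnC. Qed.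

Lemma sum_dot_row k (x : 'cV['F_2]_k) m : x != 0 ->
  (2 * \sum_(u | dot u x) m = m * 2 ^ k)%N.
Proof. by move=> x0; rewrite sum_nat_const mulnA card_dot_row // mulnC. Qed.

Lemma sum_dot_col2 k (u v : 'rV['F_2]_k) b m : u != 0 -> v != 0 -> u != v ->
  (4 * \sum_(x | (dot u x == b) && dot v x) m = m * 2 ^ k)%N.
Proof. by move=> u0 v0 uv; rewrite sum_nat_const mulnA card_dot_col2 // mulnC. Qed.

(** * Extending simplex codes *)

Lemma sim_type_weight Delta k n (G : 'M_(k, n)) u :
  sim_type Delta G -> u != 0 -> weight (u *m G) = Delta.
Proof.
case=> m mD multG u0; rewrite weight_mulmx (eq_bigr (fun=> m)) => [|x ux].
  by have := sum_dot_col m u0; lia.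
by apply: multG; apply: contraTneq ux => ->; rewrite dotx0.
Qed.

Lemma sim_extension Delta k n (G : 'M_(k, n)) c : (0 < Delta)%N ->
  sim_type Delta G -> extension Delta G c ->
  sim_type Delta (col_mx c G) \/ rm_type Delta (col_mx c G).
Proof.
move=> D0 Gt ext; have [m mD multG] := Gt; set f := mult_on G c.
have fm x : x != 0 -> (f x <= m)%N by move=> x0; rewrite -(multG x x0) mult_on_le.
have [wc nc dc [x1 x1_0 fx1]] := ext.
rewrite -/f in fx1; pose S := (\sum_(x | x != 0%R) f x)%N.
have fD : (f 0%R + S = Delta)%N := sum_mult_on_neq0 ext.
pose F u := (\sum_(x | dot u x) f x)%N.
have F2 u : u != 0 -> (2 * F u = 0 \/ 2 * F u = Delta)%N.
  by move=> u0; apply: extension_overlap => //; apply: sim_type_weight.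
(* F u is half of Delta for every u, or c avoids the word of some u0. *)
case: (pickP [pred u | (u != 0) && (F u == 0%N)]) => [u0 /andP[u0_0 /eqP Fu0]|Fn0].
  right; have f0 x : dot u0 x -> f x = 0%N.
    by move=> ux; apply/eqP; move: Fu0 => /eqP; rewrite sum_nat_eq0 => /forall_inP->.
  have ux1 : ~~ dot u0 x1 by apply/negP => /f0 e; rewrite e in fx1.
  (* Take [u] equal to 1 at [x1] and [x2]. The point [x1] makes [F u] positive, hence Delta/2. It is
     a sum over the 2^(k-2) points with [u0 = 0] and [u = 1], where [f] is at most [m], and m
     2^(k-2) = Delta/2; so the bound is attained at each of them. *)
  have key x2 : x2 != 0 -> ~~ dot u0 x2 -> f x2 = m /\ (1 < k)%N.
    move=> x2_0 ux2; have [u [uu1 uu2]] := dot_common x1_0 x2_0.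
    have u_0 : u != 0 by apply: contraTneq uu1 => ->; rewrite dot0x.
    have u_u0 : u0 != u by apply: contraNneq ux1 => ->.
    have cnt a := sum_dot_col2 false a u0_0 u_0 u_u0; split; last first.
      (* By [cnt 1], 2^k is a multiple of 4. *)
      rewrite ltnNge; apply/negP => k1; have := cnt 1%N.
      have : (0 < 2 ^ k <= 2 ^ 1)%N by rewrite expn_gt0 leq_exp2l.
      by rewrite expn1; lia.
    have FE : F u = (\sum_(x | (dot u0 x == false) && dot u x) f x)%N.
      rewrite /F (bigID (fun x => dot u0 x)) /= big1 => [|x /andP[_ /f0]//].
      by rewrite add0n; apply: eq_bigl => x; rewrite eqbF_neg andbC.
    have Fpos : (0 < F u)%N by rewrite /F (bigD1 x1) //= addn_gt0 fx1.
    have {}Fpos : (2 * F u = Delta)%N by case: (F2 u u_0) => //; lia.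
    apply: (@sum_eq_bound _ (fun x => (dot u0 x == false) && dot u x)).
    - by rewrite uu2 eqbF_neg ux2.
    - by move=> x /andP[_ ux]; apply: fm; apply: contraTneq ux => ->; rewrite dotx0.
    - by rewrite -FE; move: (cnt m); lia.
  have [_ k1] := key x1 x1_0 ux1.
  (* Give all points weight [m], with total 2 Delta. The half with [u0 = 1] has weight [A = Delta];
     the other half consists of 0 and of points where [f] is [m]. Hence
     [m + S = Delta = f 0 + S]. *)
  have f0m : f 0 = m.
    pose A := (\sum_(x | dot u0 x) m)%N;
    have A2 : (2 * A = m * 2 ^ k)%N := sum_dot_col m u0_0.
    have tot : (A + (m + S) = m * 2 ^ k)%N.
      have <- : (\sum_(x : 'cV['F_2]_k) m = m * 2 ^ k)%N.
        by rewrite sum_nat_const card_cV2 mulnC.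
      rewrite [RHS](bigID (dot u0)) /= [X in _ = (_ + X)%N](bigD1 0) /= ?dotx0 //.
      congr (_ + (_ + _))%N; rewrite /S (bigID (fun x => dot u0 x)) /=.
      rewrite big1 => [|x /andP[_ /f0]//].
      rewrite add0n; apply: eq_big => x; first by rewrite andbC.
      by case/andP => x0 ux; case: (key x x0 ux).
    by move: A2 fD tot mD; clear; lia.
  have fE x : f x = (m * ~~ dot u0 x)%N.
    case ux: (dot u0 x); first by rewrite (f0 x ux) muln0.
    have [->|x0] := eqVneq x 0; first by rewrite f0m muln1.
    by rewrite muln1; case: (key x x0); rewrite ?ux.
  (* A column with top entry 1 over [x] has multiplicity [f x], which is [m] exactly if [u0]
     vanishes at [x]; with top entry 0 it has [m - f x], which is [m] exactly if [u0] is 1 there.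
     Both are [m] times the functional [row_mx 1 u0]. *)
  exists m, (row_mx 1 u0); split.
  - by [].
  - by rewrite row_mx_eq0 negb_and u0_0 orbT.
  - by rewrite expnS; lia.
  apply: mult_col_mx => [x|x x0]; rewrite -/(f x) dot_block fE ?oner_neq0 ?eqxx //.
  rewrite multG //; case: (dot u0 x); lia.
left; have {}F2 u : u != 0 -> (2 * F u = Delta)%N.
  by move=> u0; case: (F2 u u0) => // e; have := Fn0 u; rewrite /= u0; case: (F u) e.
(* All [F u] with [u != 0] being Delta/2, the inversion formula gives
   [f x + S = Delta = f 0 + S]. *)
have key x : x != 0 -> (f x = f 0).
  move=> x0.
  have : (4 * \sum_(u | dot u x) F u = 2 ^ k * (f x + S))%N := radon_inversion f x0.
  rewrite -[4%N]/(2 * 2)%N -mulnA big_distrr /=.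
  rewrite (eq_bigr (fun=> Delta)) => [|u ux]; last first.
    by apply: F2; apply: contraTneq ux => ->; rewrite dot0x.
  have pk : (0 < 2 ^ k)%N by rewrite expn_gt0.
  rewrite sum_dot_row // (mulnC Delta) => /eqP; rewrite eqn_pmul2l // => /eqP e.
  by move: e fD; clear; lia.
have f2 : (f 0%R * 2 ^ k = Delta)%N.
  rewrite -fD /S (eq_bigr (fun=> f 0)) => [|x x0]; last exact: key.
  by rewrite sum_nat_const -card_neq0_cV mulnDr muln1 addnC mulnC.
(* Comparing [f2] with [mD] gives [m = 2 * f 0]: each multiplicity is shared equally between the top
   entries 0 and 1. *)
exists (f 0); first by rewrite expnS; lia.
apply: mult_col_mx => [x|x x0]; rewrite -/(f x).
  by have [->|/key] := eqVneq x 0.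
rewrite key // multG //.
have pk : (0 < 2 ^ k)%N by rewrite expn_gt0.
by nia.
Qed.

(** * Extending Reed-Muller codes *)

Lemma exists_notin (T : finType) (A : {set T}) : (#|A| < #|T|)%N -> exists x, x \notin A.
Proof.
move=> cA; apply/existsP; apply: contraLR cA => /existsPn h.
by rewrite -leqNgt; apply: subset_leq_card; apply/subsetP => x _; rewrite -[_ \in _]negbK h.
Qed.

Lemma dot_sum k (v : 'rV['F_2]_k) (P : pred 'cV['F_2]_k) :
  dot v (\sum_(x | P x) x) = odd #|[pred x | P x && dot v x]|.
Proof.
rewrite -sum1_card big_mkcondr /=.
elim/big_rec2: _ => [|x S N _ IH]; first by rewrite dotx0.
by rewrite dotDr IH oddD; case: (dot v x).
Qed.

(** Every functional [v] vanishes on the sum, because the number of points where [u] and [v] are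
    both 1 is 0, 2^(k-1) or 2^(k-2), which is even. In dimension 3 this gives the relation among the
    four points of a future parity check code. *)
Lemma sum_dot_eq0 k (u : 'rV['F_2]_k) : (2 < k)%N -> u != 0 ->
  \sum_(x | dot u x) x = 0.
Proof.
case: k u => [|[|[|k]]] // u _ u0; apply: contraTeq isT => /dot_separate_zero[v].
rewrite dot_sum; have [->|v0] := eqVneq v 0.
  by rewrite eq_card0 // => x; rewrite inE dot0x andbF.
have [<-|uv] := eqVneq u v.
  rewrite (@eq_card _ _ [pred x | dot u x]) => [|x]; last by rewrite !inE andbb.
  by have := card_dot_col u0; rewrite !expnS; set N := #|_|; lia.
rewrite (@eq_card _ _ [pred x | (dot u x == true) && dot v x]) => [|x]; last first.
  by rewrite !inE eqb_id.
by have := card_dot_col2 true u0 v0 uv; rewrite !expnS; set N := #|_|; lia.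
Qed.

(** All columns equal to [x1] get top entry 1, and so do Delta/2 zero columns of [G]. Thus [x1] is
    replaced by the two points (1, [x1]) and (1, 0), whose sum is (0, [x1]), and the points still
    sum to 0. The bound [2 < k] lets the lemma start from a Reed-Muller code of dimension 3. *)
Lemma pc_type_extend Delta k n (G : 'M_(k, n)) c (P : {set 'cV['F_2]_k}) x1 :
  (2 < k)%N -> #|P| = k.+1 -> 0 \notin P -> \sum_(p in P) p = 0 ->
  (forall x, x != 0 -> (2 * mult G x = Delta * (x \in P))%N) ->
  x1 \in P ->
  (forall x, (2 * mult_on G c x = Delta * ((x == x1) || (x == 0%R)))%N) ->
  pc_type Delta (col_mx c G).
Proof.
move=> k2 cP P0 sP mG x1P mc.
have x1_0 : x1 != 0 by apply: contraNneq P0 => <-.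
pose Q := [set col_mx (0 : 'M_1) p | p in P :\ x1].
have inj0 : injective (fun p : 'cV['F_2]_k => col_mx (0 : 'M_1) p).
  by move=> p q /eq_col_mx[].
have in1 x y : (col_mx (1 : 'M['F_2]_1) x == col_mx 1 y) = (x == y).
  by apply/eqP/eqP => [/eq_col_mx[]|->].
have in10 x y : (col_mx (1 : 'M['F_2]_1) x == col_mx 0 y) = false.
  by apply/eqP => /eq_col_mx[/eqP]; rewrite oner_eq0.
have in01 x y : (col_mx (0 : 'M['F_2]_1) x == col_mx 1 y) = false.
  by rewrite eq_sym in10.
have inQ1 x : (col_mx (1 : 'M['F_2]_1) x \in Q) = false.
  by apply/imsetP => -[p _ /eqP]; rewrite in10.
exists (col_mx 1 x1 |: (col_mx 1 0 |: Q)); split.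
- by [].
- rewrite !cardsU1 !inE in1 (negPf x1_0) !inQ1 card_imset //.
  by have := cardsD1 x1 P; rewrite x1P cP /=; set N := #|_|; lia.
- rewrite !inE; apply/negP => /or3P[|| /imsetP[p]].
  + by rewrite eq_sym col_mx_eq0 oner_eq0.
  + by rewrite eq_sym col_mx_eq0 oner_eq0.
  + rewrite !inE => /andP[_ pP] /esym/eqP; rewrite col_mx_eq0 => /andP[_ /eqP p0].
    by rewrite -p0 pP in P0.
- rewrite big_setU1 ?big_setU1 ?inQ1 ?inE ?in1 ?inQ1 ?(negPf x1_0) //=.
  rewrite big_imset /=; last by move=> p q _ _ /inj0.
  rewrite addrA add_col_mx addr0 F2_addvv.
  have -> : \sum_(p in P :\ x1) col_mx (0 : 'M['F_2]_1) p = col_mx 0 (\sum_(p in P :\ x1) p).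
    elim/big_rec2: _ => [|p S T _ ->]; first by rewrite col_mx0.
    by rewrite add_col_mx addr0.
  by rewrite add_col_mx addr0 -big_setD1 // sP col_mx0.
move=> y; rewrite -[y]vsubmxK; move: (usubmx y) (dsubmx y) => b x.
have [->|b0] := eqVneq b 0; last first.
  by move=> _; rewrite mult_block1 // (mx11_eq1 b0) mc !inE !in1 inQ1 orbF.
rewrite col_mx_eq0 eqxx /= => x0; rewrite !inE !in01 /=.
have -> : (col_mx (0 : 'M['F_2]_1) x \in Q) = (x != x1) && (x \in P).
  by rewrite mem_imset // !inE.
have := mult_block0 G c x; have := mG x x0; have := mc x.
rewrite (negPf x0) orbF; have [->|_] /= := eqVneq x x1; rewrite ?x1P; lia.
Qed.

(** There are 2^(k-2) points where [u] and [u0] are both 1, each of multiplicity [m]. The functional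
    [u0] itself gives weight 2 Delta. *)
Lemma rm_type_weight Delta k n (G : 'M_(k, n)) m u0 u :
  (m * 2 ^ k = 4 * Delta)%N -> u0 != 0 ->
  (forall x, x != 0 -> mult G x = (m * dot u0 x)%N) ->
  u != 0 -> u != u0 -> weight (u *m G) = Delta.
Proof.
move=> mD u0_0 multG u_0 u_u0; rewrite weight_mulmx.
have -> : (\sum_(x | dot u x) mult G x = \sum_(x | (dot u0 x == true) && dot u x) m)%N.
  rewrite big_mkcondl /=; apply: eq_bigr => x ux; rewrite multG; last first.
    by apply: contraTneq ux => ->; rewrite dotx0.
  by case: (dot u0 x); rewrite ?muln1 ?muln0.
by move: (@sum_dot_col2 k u0 u true m u0_0 u_0); rewrite eq_sym => /(_ u_u0); lia.
Qed.

Lemma rm_extension Delta k n (G : 'M_(k, n)) c : (0 < Delta)%N ->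
  rm_type Delta G -> extension Delta G c ->
  rm_type Delta (col_mx c G) \/ pc_type Delta (col_mx c G).
Proof.
move=> D0 [m [u0 [k2 u0_0 mD multG]]] ext; set f := mult_on G c.
have fm x : x != 0 -> (f x <= m * dot u0 x)%N by move=> x0; rewrite -(multG x x0) mult_on_le.
have f0 x : x != 0 -> ~~ dot u0 x -> f x = 0%N.
  by move=> /fm fx /negPf ux; move: fx; rewrite ux muln0 leqn0 => /eqP.
have [wc nc dc [x1 x1_0 fx1]] := ext.
rewrite -/f in fx1; pose S := (\sum_(x | x != 0%R) f x)%N.
have fD : (f 0%R + S = Delta)%N := sum_mult_on_neq0 ext.
have ux1 : dot u0 x1 by apply: contraTT fx1 => /f0 -> //.
pose F u := (\sum_(x | dot u x) f x)%N.
have F2 u : u != 0 -> u != u0 -> (2 * F u = 0 \/ 2 * F u = Delta)%N.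
  move=> u_0 u_u0; apply: extension_overlap => //.
  exact: rm_type_weight mD u0_0 multG u_0 u_u0.
have FE u : F u = (\sum_(x | x != 0%R) if dot u x then f x else 0)%N.
  rewrite -big_mkcondr; apply: eq_bigl => x.
  by have [->|] := eqVneq x 0; rewrite ?dotx0.
(* Away from 0, [f] lives on the points with [u0 = 1], where exactly one of [u] and [u + u0] is
   1. *)
have FS u : (F u + F (u + u0)%R = S)%N.
  rewrite !FE -big_split; apply: eq_bigr => x x0 /=; rewrite dotDl.
  have := f0 x x0; case: (dot u0 x) => [_|-> //]; last by case: (dot u x).
  by case: (dot u x); rewrite /= ?addn0.
have Fu0 : F u0 = S.
  by have := FS 0; rewrite add0r {1}/F big1 // => x; rewrite dot0x.
have Fpos u x : x != 0 -> (0 < f x)%N -> dot u x -> (0 < F u)%N.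
  by move=> x0 fx ux; rewrite /F (bigD1 x) //= addn_gt0 fx.
have addu u : u != 0 -> u != u0 -> u + u0 != 0 /\ u + u0 != u0.
  by move=> u_0 u_u0; rewrite F2_addv_eq0 u_u0 -subr_eq0 addrK u_0.
have S0 : (0 < S)%N by rewrite -Fu0; apply: Fpos fx1 ux1.
case: (pickP [pred u | [&& u != 0, u != u0 & F u == 0%N]]) => [u1|Fn0].
  case/and3P=> u1_0 u1_u0 /eqP Fu1; right.
  have SD : (2 * S = Delta)%N.
    have [a b] := addu _ u1_0 u1_u0; have := FS u1; rewrite Fu1 add0n => e.
    by case: (F2 _ a b); rewrite e //; move: S0; clear; lia.
  (* A second point [x] with [f x > 0] could be separated from [x1] by some [u]; then [F u] and
     [F (u + u0)] would both be positive, hence Delta/2, although their sum [S] is Delta/2. *)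
  have fx x : x != 0 -> x != x1 -> f x = 0%N.
    move=> x0 xx1; apply/eqP; rewrite -leqn0 leqNgt; apply/negP => fx.
    have ux : dot u0 x by apply: contraTT fx => /f0 -> //.
    have [u [uu1 uu]] : exists u, dot u x1 /\ dot u x = false.
      by apply: dot_separate; rewrite // eq_sym.
    have u_0 : u != 0 by apply: contraTneq uu1 => ->; rewrite dot0x.
    have u_u0 : u != u0 by apply: contraFneq uu => ->.
    have [a b] := addu _ u_0 u_u0.
    have p1 := Fpos u x1 x1_0 fx1 uu1.
    have p2 : (0 < F (u + u0)%R)%N by apply: (Fpos _ x) => //; rewrite dotDl uu ux.
    have e1 := F2 _ u_0 u_u0; have e2 := F2 _ a b; have e3 := FS u.
    by move: p1 p2 e1 e2 e3 SD D0; clear; lia.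
  have SE : S = f x1 by rewrite /S (bigD1 x1) //= big1 ?addn0 // => x /andP[]; apply: fx.
  have fm1 := fm x1 x1_0; rewrite ux1 muln1 in fm1.
  (* Here Delta/2 = [f x1] is at most [m], which is Delta / 2^(k-2). *)
  have k3 : k = 3%N.
    case: (ltngtP k 3) k2 => // k3 _.
    have : (2 ^ 4 <= 2 ^ k)%N by rewrite leq_exp2l.
    by move: mD fm1 SD SE D0; clear; nia.
  have cP : (2 * #|[set x | dot u0 x]| = 2 ^ k)%N.
    by rewrite -(card_dot_col u0_0); congr (_ * _)%N; apply: eq_card => x; rewrite !inE.
  have mD2 : (2 * m = Delta)%N by move: mD; rewrite k3; clear; lia.
  (* In dimension 3 the affine hyperplane [u0 = 1] has four points with sum 0, and [m] is Delta/2: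
     this Reed-Muller code is also a parity check code. *)
  apply: (@pc_type_extend _ _ _ _ _ [set x | dot u0 x] x1); rewrite ?inE ?dotx0 //.
  - by have e : (2 ^ k = 8)%N by [rewrite k3]; move: cP e k3; set N := #|_|; clear; lia.
  - by under eq_bigl do rewrite inE; apply: sum_dot_eq0.
  - by move=> x x0; rewrite multG // inE mulnA mD2.
  - move=> x; rewrite -/(f x); have [->|xx1] := eqVneq x x1; first by rewrite -SE SD muln1.
    have [->|x0] /= := eqVneq x 0; last by rewrite fx // !muln0.
    by move: SD fD; clear; lia.
left; have {}F2 u : u != 0 -> u != u0 -> (2 * F u = Delta)%N.
  move=> u_0 u_u0; case: (F2 u u_0 u_u0) => // e.
  by have := Fn0 u; rewrite /= u_0 u_u0; case: (F u) e.
have SD : S = Delta.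
  have [|u] := @exists_notin _ [set 0; u0].
    have : (2 ^ 3 <= 2 ^ k)%N by rewrite leq_exp2l.
    by rewrite card_rV2 cards2; case: (_ != _); lia.
  rewrite !inE negb_or => /andP[u_0 u_u0]; have [a b] := addu _ u_0 u_u0.
  apply/eqP; rewrite -(eqn_pmul2l (isT : 0 < 2)%N) -(FS u) mulnDr.
  by rewrite (F2 _ u_0 u_u0) (F2 _ a b) addnn mul2n.
(* In the inversion formula the term of [u0] is [S = Delta] while all others are Delta/2; this
   excess leaves [f x] equal to 2 Delta / 2^k instead of 0. *)
have key x : dot u0 x -> (f x * 2 ^ k = 2 * Delta)%N.
  move=> ux; have x0 : x != 0 by apply: contraTneq ux => ->; rewrite dotx0.
  have : (4 * \sum_(u | dot u x) F u = 2 ^ k * (f x + S))%N := radon_inversion f x0.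
  rewrite -[4%N]/(2 * 2)%N -mulnA big_distrr /= (bigD1 u0) //= Fu0 SD.
  rewrite (eq_bigr (fun=> Delta)) => [|u /andP[uux u_u0]]; last first.
    by apply: F2 => //; apply: contraTneq uux => ->; rewrite dot0x.
  have : (2 * \sum_(u | dot u x) Delta = Delta * 2 ^ k)%N by apply: sum_dot_row.
  rewrite (bigD1 u0) //=; set T := (\sum_(u | _) Delta)%N; clear; lia.
have pk : (0 < 2 ^ k)%N by rewrite expn_gt0.
have gE := key x1 ux1.
have fE x : f x = (f x1 * dot u0 x)%N.
  have [->|x0] := eqVneq x 0; first by rewrite dotx0 muln0; move: fD SD; clear; lia.
  case ux: (dot u0 x); last by rewrite muln0 f0 // ux.
  by have := key x ux; move: gE pk; clear; nia.
(* Since [f] is [f x1] times [u0], with [2 * f x1 = m], the multiplicities do not depend on the top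
   entry. *)
exists (f x1), (row_mx 0 u0); split.
- by move: k2; clear; lia.
- by rewrite row_mx_eq0 eqxx.
- by rewrite expnS; move: gE; clear; lia.
apply: mult_col_mx => [x|x x0]; rewrite -/(f x) dot_block eqxx /= (fE x) //.
by rewrite multG //; move: gE mD pk; clear; case: (dot u0 x); nia.
Qed.

(** * Extending parity check codes *)

(** The row space of [M] lies in the kernel of the all-one column, and both have dimension [k]. *)
Lemma mem_PC_row_free k (M : 'M_(k, k.+1)) (w : 'rV_k.+1) :
  row_free M -> (forall i, \sum_j M i j = 0) -> (w \in PC k) = (w <= M)%MS.
Proof.
move=> Mfree M0; pose one : 'cV['F_2]_k.+1 := const_mx 1.
have MK : (M <= kermx one)%MS.
  apply/sub_kermxP/matrixP => i j; rewrite !mxE -[RHS](M0 i).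
  by apply: eq_bigr => l _; rewrite mxE mulr1.
have KM : (kermx one <= M)%MS.
  have := mxrank_leqif_sup MK; rewrite /leqif => -[_ <-].
  rewrite mxrank_ker (eqP Mfree); have -> : \rank one = 1%N; last by rewrite subn1.
  apply/eqP; rewrite eqn_leq rank_leq_col lt0n mxrank_eq0.
  by apply/eqP => /matrixP/(_ 0 0); rewrite !mxE.
rewrite mem_PC; apply/eqP/idP => [w0|/submx_trans/(_ MK)/sub_kermxP/matrixP/(_ 0 0)].
  apply: submx_trans KM; apply/sub_kermxP/matrixP => i j; rewrite !ord1 !mxE -[RHS]w0.
  by apply: eq_bigr => l _; rewrite mxE mulr1.
by rewrite !mxE => h; rewrite -[RHS]h; apply: eq_bigr => l _; rewrite mxE mulr1.
Qed.

(** The matrix with the points of [P] as columns has independent rows because [P] spans, and each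
    row sums to 0. So the value patterns of functionals on [P] are exactly the words of the parity
    check code. *)
Lemma PC_points k (P : {set 'cV['F_2]_k}) :
  #|P| = k.+1 -> \sum_(p in P) p = 0 ->
  (forall u, (forall p, p \in P -> ~~ dot u p) -> u = 0) ->
  exists q : 'I_k.+1 -> 'cV['F_2]_k,
    [/\ injective q, forall y, q y \in P, forall p, p \in P -> exists y, q y = p
      & forall w, (w \in PC k) <-> exists u, forall y, (w 0 y != 0) = dot u (q y)].
Proof.
move=> cP sP spanP; pose q y : 'cV['F_2]_k := enum_val (cast_ord (esym cP) y).
have qP y : q y \in P by apply: enum_valP.
have qsurj p : p \in P -> exists y, q y = p.
  move=> pP; exists (cast_ord cP (enum_rank_in pP p)).
  by rewrite /q cast_ordK enum_rankK_in.
exists q; split=> //; first by move=> y y' /enum_val_inj/cast_ord_inj.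
pose M := \matrix_(i, j) q j i 0.
have colM j : col j M = q j by apply/colP => i; rewrite !mxE.
have Mfree : row_free M.
  apply: inj_row_free => u uM; apply: spanP => p /qsurj[y <-].
  by rewrite -colM dot_col uM mxE eqxx.
have M0 i : \sum_j M i j = 0.
  transitivity ((\sum_(p in P) p) i 0); last by rewrite sP mxE.
  rewrite summxE [RHS]big_enum_val /=.
  rewrite (reindex (cast_ord (esym cP))) /=; last first.
    by exists (cast_ord cP) => j _; rewrite ?cast_ordK ?cast_ordKV.
  by apply: eq_bigr => j _; rewrite mxE.
move=> w; rewrite (mem_PC_row_free w Mfree M0); split.
  by case/submxP=> u ->; exists u => y; rewrite -colM dot_col.
case=> u uw; apply/submxP; exists u; apply/rowP => y.
have := uw y; rewrite -colM dot_col.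
case: (eqVneq (w 0 y) 0) => [->|/F2_neq0 ->] /esym; first by move/negbFE/eqP.
by move/F2_neq0.
Qed.

Lemma sum_dot_pair k (P : {set 'cV['F_2]_k}) u p q (h : 'cV['F_2]_k -> nat) :
  p != q -> (forall x, x != 0 -> x \notin P -> h x = 0%N) ->
  dot u p -> dot u q -> (forall x, x \in P -> dot u x -> (x == p) || (x == q)) ->
  (\sum_(x | dot u x) h x = h p + h q)%N.
Proof.
move=> pq h0 up uq uP; rewrite (bigD1 p) //= (bigD1 q) //=; last by rewrite uq eq_sym.
rewrite big1 ?addn0 // => x /andP[/andP[ux xp] xq]; apply: h0.
  by apply: contraTneq ux => ->; rewrite dotx0.
by apply/negP => /uP/(_ ux); rewrite (negPf xp) (negPf xq).
Qed.

(** All nonzero columns of [G] lie in [P], so a functional vanishing on [P] gives the zero word. *)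
Lemma pc_spanning Delta k n (G : 'M['F_2]_(k, n)) (P : {set 'cV['F_2]_k}) u :
  row_free G -> (forall x, x != 0 -> (2 * mult G x = Delta * (x \in P))%N) ->
  (forall p, p \in P -> ~~ dot u p) -> u = 0.
Proof.
move=> Gfree mG uP; apply: (row_free_inj Gfree); rewrite mul0mx.
apply/rowP => j; rewrite [RHS]mxE; apply/eqP; rewrite -[_ == 0]negbK -dot_col.
have [->|x0] := eqVneq (col j G) 0; first by rewrite dotx0.
apply: uP; have := mG _ x0; case: (_ \in P) => //; rewrite muln0 => /eqP.
rewrite muln_eq0 /= cards_eq0 => /eqP/setP/(_ j).
by rewrite !inE eqxx.
Qed.

Lemma pc_extension Delta k n (G : 'M_(k, n)) c : (0 < Delta)%N -> row_free G ->
  pc_type Delta G -> extension Delta G c -> pc_type Delta (col_mx c G).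
Proof.
move=> D0 Gfree [P [k3 cP P0 sP mG]] ext; set f := mult_on G c.
have m0 x : x != 0 -> x \notin P -> mult G x = 0%N.
  by move=> x0 xP; have := mG x x0; rewrite (negPf xP) muln0; lia.
have f0 x : x != 0 -> x \notin P -> f x = 0%N.
  by move=> x0 xP; apply/eqP; rewrite -leqn0 -(m0 x x0 xP) mult_on_le.
have Pn0 x : x \in P -> x != 0 by apply: contraTneq => ->.
have [wc nc dc [p1 p1_0 fp1]] := ext; rewrite -/f in fp1.
have p1P : p1 \in P by apply: contraTT fp1 => /(f0 p1 p1_0) ->.
pose S := (\sum_(x | x != 0%R) f x)%N.
have fD : (f 0%R + S = Delta)%N := sum_mult_on_neq0 ext.
have [q [qinj qP qsurj wq]] := PC_points cP sP (fun u => pc_spanning Gfree mG).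
(* The pattern with ones exactly at [p] and [p'] is even, so some [u] realizes it. Its word has
   weight Delta/2 + Delta/2, and its overlap with [c] is [f p + f p']. *)
have pair p p' : p \in P -> p' \in P -> p != p' ->
    (2 * (f p + f p') = 0 \/ 2 * (f p + f p') = Delta)%N.
  move=> /[dup] pP /qsurj[a qa] /[dup] p'P /qsurj[b qb] pp'.
  have ab : a != b by apply: contraNneq pp' => ab; rewrite -qa -qb ab.
  have : delta_mx 0 a + delta_mx 0 b \in PC k.
    rewrite mem_PC; apply/eqP; rewrite (bigD1 a) //= (bigD1 b) 1?eq_sym //= big1 => [|y].
      rewrite !mxE !eqxx /= (negPf ab) eq_sym (negPf ab).
      by apply: val_inj.
    by case/andP=> /negPf ya /negPf yb; rewrite !mxE ya yb /= addr0.
  case/wq=> u uE; have uq y : dot u (q y) = (y == a) || (y == b).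
    rewrite -uE !mxE /=; have [->|ya] := eqVneq y a; first by rewrite (negPf ab).
    by case: (y == b).
  have up : dot u p by rewrite -qa uq eqxx.
  have up' : dot u p' by rewrite -qb uq eqxx orbT.
  have uP x : x \in P -> dot u x -> (x == p) || (x == p').
    by case/qsurj=> y <-; rewrite uq -qa -qb !(inj_eq qinj).
  rewrite -(sum_dot_pair pp' f0 up up' uP); apply: extension_overlap => //.
  rewrite weight_mulmx (sum_dot_pair pp' m0 up up' uP).
  by have := mG p (Pn0 _ pP); have := mG p' (Pn0 _ p'P); rewrite pP p'P; lia.
have SP : S = (\sum_(p in P) f p)%N.
  rewrite /S (bigID (mem P)) /= [X in (_ + X)%N]big1 => [|x /andP[x0 xP]]; last exact: f0.
  rewrite addn0; apply: eq_bigl => x; case: (boolP (x \in P)) => [/Pn0->|]; rewrite ?andbT ?andbF //.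
(* If [f] were positive at two points, the pair sums with any third point would all be Delta/2,
   making [f] equal to Delta/4 on all of [P]; its at least five points would exceed the total
   Delta. *)
have single p : p \in P -> p != p1 -> f p = 0%N.
  move=> pP pp1; apply/eqP; rewrite -leqn0 leqNgt; apply/negP => fp.
  have e1 := pair _ _ pP p1P pp1.
  have all4 r : r \in P -> (4 * f r = Delta)%N.
    have third r' : r' \in P -> r' != p -> r' != p1 ->
        (4 * f r' = Delta /\ 4 * f p = Delta /\ 4 * f p1 = Delta)%N.
      move=> rP rp rp1; have e2 := pair _ _ rP pP rp; have e3 := pair _ _ rP p1P rp1.
      by move: e1 e2 e3 fp fp1; clear; lia.
    have [z] : exists z, z \in P :\: [set p; p1].
      apply/set0Pn; rewrite -card_gt0 cardsD.
      have : (#|P :&: [set p; p1]| <= #|[set p; p1]|)%N by rewrite subset_leq_card // subsetIr.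
      by rewrite cards2 cP pp1; set N := #|_|; move: k3; clear; lia.
    rewrite !inE negb_or -andbA => /and3P[zp zp1 zP]; have [_ [h1 h2]] := third z zP zp zp1.
    move=> rP; have [->//|rp] := eqVneq r p; have [->//|rp1] := eqVneq r p1.
    by case: (third r rP rp rp1).
  have : (4 * S = #|P| * Delta)%N.
    by rewrite SP big_distrr /= -sum_nat_const; apply: eq_bigr.
  by rewrite cP; move: fD D0 k3; clear; nia.
have Sp1 : S = f p1.
  by rewrite SP (bigD1 p1) //= big1 ?addn0 // => p /andP[]; apply: single.
have fp1D : (2 * f p1 = Delta)%N.
  have [z] : exists z, z \in P :\ p1.
    apply/set0Pn; rewrite -card_gt0; have := cardsD1 p1 P; rewrite p1P cP.
    by set N := #|_|; move: k3; clear; lia.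
  rewrite !inE => /andP[zp1 zP]; have := pair _ _ zP p1P zp1; rewrite (single z) //.
  by move: fp1; clear; lia.
apply: (@pc_type_extend _ _ _ _ _ P p1) => //; first by move: k3; clear; lia.
move=> x; rewrite -/(f x); have [->|xp1] := eqVneq x p1; first by rewrite fp1D muln1.
have [->|x0] /= := eqVneq x 0; first by move: Sp1 fD fp1D; clear; lia.
by case: (boolP (x \in P)) => xP; [rewrite single | rewrite f0]; rewrite ?muln0.
Qed.

(** * Choosing generators one word at a time *)

Lemma mem_generated_code k n (G : 'M['F_2]_(k, n)) w :
  reflect (exists u, w = u *m G) (w \in generated_code G).
Proof.
have -> : generated_code G = limg (linfun (mulmxr G : 'rV_k -> 'rV_n)).
  apply/eqP; rewrite eqEsubv; apply/andP; split.
    apply/span_subvP => _ /mapP[i _ ->]; apply/memv_imgP.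
    by exists (delta_mx 0 i); rewrite ?memvf // lfunE /= -rowE.
  apply/subvP => _ /memv_imgP[u _ ->]; rewrite lfunE /= mulmx_sum_row.
  apply: memv_suml => i _; apply: memvZ; apply: memv_span.
  by apply: map_f; rewrite mem_enum.
apply: (iffP memv_imgP) => [[u _ ->]|[u ->]]; exists u; rewrite ?memvf ?lfunE //.
Qed.

Lemma mulmx_mem_code k n (C : code n) (G : 'M_(k, n)) u :
  (forall i, row i G \in C) -> u *m G \in C.
Proof. by move=> GC; rewrite mulmx_sum_row; apply: memv_suml => i _; apply: memvZ. Qed.

Lemma dim_generated_code_le k n (G : 'M['F_2]_(k, n)) : (\dim (generated_code G) <= k)%N.
Proof. by apply: leq_trans (dim_span _) _; rewrite size_map size_enum_ord. Qed.

Lemma dim_generated_code k n (G : 'M['F_2]_(k, n)) : row_free G ->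
  \dim (generated_code G) = k.
Proof.
move=> Gfree; apply/eqP; rewrite eqn_leq dim_generated_code_le /=.
have dk : k = \dim (fullv : {vspace 'rV['F_2]_k}) by rewrite dimvf /dim /= mul1n.
have k0 : (fullv :&: lker (linfun (mulmxr G : 'rV_k -> 'rV_n)) = 0)%VS.
  apply/eqP; rewrite -subv0; apply/subvP => u; rewrite memv_cap memv_ker lfunE /= memv0.
  by case/andP=> _ /eqP uG; apply/eqP/(row_free_inj Gfree); rewrite uG mul0mx.
rewrite {1}dk -(limg_dim_eq k0); apply: dimvS; apply/subvP => _ /memv_imgP[u _ ->].
by apply/mem_generated_code; exists u; rewrite lfunE.
Qed.

Lemma span_coord0 n (X : seq 'rV['F_2]_n) j d :
  (forall c, c \in X -> c 0 j = 0) -> d \in <<X>>%VS -> d 0 j = 0.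
Proof.
move=> X0; pose K := lker (linfun (mulmxr (delta_mx j 0 : 'cV['F_2]_n) : 'rV_n -> 'M_1)).
have memK c : (c \in K) = (c 0 j == 0).
  rewrite memv_ker lfunE /= -colE -[LHS]negbK mx11_neq0 negbK.
  by rewrite mxE.
move=> dX; have /subvP/(_ d dX) : (<<X>> <= K)%VS by apply/span_subvP => c /X0 c0; rewrite memK c0.
by rewrite memK => /eqP.
Qed.

(** If every word of weight Delta outside the code [D] of [G] avoided the support of [D], these
    words would span a code [D'] decomposing [C]; [D'] is nonzero because [D] is too small to be
    [C]. *)
Lemma exists_extension Delta k n (C : code n) (G : 'M_(k, n)) :
  indecomposable C -> divisible_code Delta C -> spanned_by_weight Delta C ->
  (forall i, row i G \in C) -> G != 0 -> (k < \dim C)%N ->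
  exists2 c, c \in C & extension Delta G c.
Proof.
move=> indC divC spanC GC G0 kC.
pose W := [pred c : 'rV['F_2]_n | (c \in C) && (weight c == Delta)].
pose D := generated_code G.
have DC : (D <= C)%VS by apply/subvP => _ /mem_generated_code[u ->]; apply: mulmx_mem_code.
case: (pickP [pred c | [&& W c, c \notin D & [exists j, (c 0 j != 0) && (col j G != 0)]]]).
  move=> c /and3P[/andP[cC /eqP wc] cD /existsP[j /andP[cj Gj]]]; exists c => //.
  split=> //.
  - by move=> u; apply: contraNneq cD => ->; apply/mem_generated_code; exists u.
  - by move=> u; apply: divC; apply: memvD => //; apply: mulmx_mem_code.
  exists (col j G) => //; apply/card_gt0P; exists j.
  by rewrite inE eqxx cj.
move=> none; case: indC.
pose D' : code n := <<[seq c <- enum {: 'rV['F_2]_n} | W c & c \notin D]>>%VS.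
have sumD : (D + D')%VS = C.
  apply/eqP; rewrite eqEsubv subv_add DC /=; apply/andP; split.
    by apply/span_subvP => c; rewrite mem_filter => /andP[/andP[/andP[]]].
  rewrite -{1}spanC; apply/span_subvP => c; rewrite mem_filter => /andP[Wc _].
  case: (boolP (c \in D)) => cD; first by rewrite -[c]addr0 memv_add ?mem0v.
  rewrite -[c]add0r memv_add ?mem0v //; apply: memv_span.
  by rewrite mem_filter mem_enum memvf andbT; apply/andP.
exists D, D'; split=> //.
- apply: contraNneq G0 => D0; apply/eqP/row_matrixP => i; rewrite row0.
  apply/eqP; rewrite -memv0 -D0; apply/mem_generated_code.
  by exists (delta_mx 0 i); rewrite -rowE.
- apply: contraTneq kC => D'0; rewrite -leqNgt -sumD D'0 addv0.
  exact: dim_generated_code_le.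
rewrite disjoint_subset; apply/subsetP => j; rewrite !inE.
case/existsP=> _ /andP[/mem_generated_code[u ->] uj]; apply/existsP => -[d /andP[dD' dj]].
have Gj : col j G != 0 by apply: contraTneq uj => Gj; rewrite -dot_col Gj dotx0.
case/negP: dj; apply/eqP; apply: span_coord0 dD' => c.
rewrite mem_filter => /andP[/andP[Wc cD] _]; apply/eqP/negPn/negP => cj.
have /negP[] := negbT (none c); apply/and3P; split=> //.
by apply/existsP; exists j; rewrite cj Gj.
Qed.

Lemma base_type Delta n (c : 'rV['F_2]_n) : weight c = Delta -> sim_type Delta c.
Proof.
move=> wc; exists Delta; first by rewrite expn1 mulnC.
move=> x /mx11_eq1 ->; rewrite -wc; apply: eq_card => j; rewrite !inE.
apply/eqP/idP => [/matrixP/(_ 0 0)|/F2_neq0 cj]; first by rewrite !mxE => ->.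
by apply/matrixP => a b; rewrite !ord1 !mxE cj.
Qed.

(** Induction on the number of generators. The partial matrices may have zero columns even if [C]
    has full length, which is why the types leave the multiplicity of 0 free. *)
Lemma exists_typed_generators Delta n (C : code n) : (0 < Delta)%N ->
  indecomposable C -> divisible_code Delta C -> spanned_by_weight Delta C ->
  forall k, (0 < k <= \dim C)%N -> exists G : 'M_(k, n),
    [/\ forall i, row i G \in C, row_free G
      & [\/ sim_type Delta G, rm_type Delta G | pc_type Delta G]].
Proof.
move=> D0 indC divC spanC; elim=> [//|[|k] IH] /= kC.
  have [c cC wc] : exists2 c, c \in C & weight c = Delta.
    have := spanC; rewrite /spanned_by_weight; case E: (filter _ _) => [|c s] sp.
      by move: kC; rewrite -sp span_nil dimv0.
    have := mem_head c s; rewrite -E mem_filter => /andP[/andP[cC /eqP wc] _].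
    by exists c.
  exists c; split.
  - by move=> i; rewrite (_ : row i c = c) //; apply/rowP => j; rewrite mxE ord1.
  - rewrite /row_free rank_rV; have : weight c != 0%N by rewrite wc -lt0n.
    by rewrite weight_eq0 => ->.
  - by apply: Or31; apply: base_type.
have [|G [GC Gfree Gtype]] := IH; first by exact: ltnW kC.
have G0 : G != 0 by apply: contraTneq Gfree => ->; rewrite /row_free mxrank0.
have [c cC ext] := exists_extension indC divC spanC GC G0 kC.
exists (col_mx c G); split.
- move=> i; case: (split_ordP (i : 'I_(1 + k.+1))) => j ->.
    rewrite (_ : row _ _ = c) //; apply: etrans (rowKu _ _ _) _.
    by apply/rowP => l; rewrite mxE ord1.
  by rewrite (_ : row _ _ = row j G) //; apply: rowKd.
- have [_ nc _ _] := ext; apply: (@inj_row_free _ (1 + k.+1)) => v; rewrite -[v](@hsubmxK _ 1 1 k.+1) mul_row_col_F2.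
  move: (lsubmx _) (rsubmx _) => a u; have [->|a0] := eqVneq a 0.
    rewrite add0r => uG; have -> : u = 0 by apply: (row_free_inj Gfree); rewrite uG mul0mx.
    by rewrite row_mx0.
  by move/eqP; rewrite F2_addv_eq0 (negPf (nc u)).
case: Gtype => Gt.
- by case: (sim_extension D0 Gt ext); [apply: Or31 | apply: Or32].
- by case: (rm_extension D0 Gt ext); [apply: Or32 | apply: Or33].
- by apply: Or33; apply: pc_extension.
Qed.

(** * Isomorphism with the listed codes *)

(** The map [p] tells which coordinate of [D] is copied at each coordinate of [C]. Numbering the [m]
    elements of each fibre yields the permutation. *)
Lemma code_iso_repetition m n N (C : code n) (D : code N) (p : 'I_n -> 'I_N) :
  (forall y, #|[set j | p j == y]| = m) ->
  (forall w, w \in C <-> exists2 d, d \in D & forall j, w 0 j = d 0 (p j)) ->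
  code_iso C (repetition m D).
Proof.
move=> cp memC; have e : n = (m * N)%N.
  have := card_fibres p predT predT; rewrite (eq_bigr (fun=> m)); last first.
    by move=> y _; rewrite -(cp y); apply: eq_card => j; rewrite !inE andbT.
  rewrite sum_nat_const card_ord mulnC => <-.
  by rewrite -[LHS]card_ord; apply: eq_card => j; rewrite !inE.
subst n; exists (erefl _).
pose g (iy : 'I_m * 'I_N) : 'I_(m * N) := enum_val (cast_ord (esym (cp iy.2)) iy.1).
have pg iy : p (g iy) = iy.2 by have := enum_valP (cast_ord (esym (cp iy.2)) iy.1); rewrite inE => /eqP.
have ginj : injective g.
  move=> [i y] [i' y'] e; have := congr1 p e; rewrite !pg /= => yy; subst y'.
  by move: e => /enum_val_inj/cast_ord_inj /= ->.
(* The inverse of [mxvec_index], as [decE] records. *)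
pose dec (x : 'I_(m * N)) := enum_val (cast_ord (esym (mxvec_cast m N)) x).
have sinj : injective (g \o dec).
  by apply: inj_comp => // x y /enum_val_inj/cast_ord_inj.
have decE i y : dec (mxvec_index i y) = (i, y) by rewrite /dec /mxvec_index cast_ordK enum_rankK.
exists (perm sinj) => w; rewrite castmx_id.
apply/idP/mem_repetition => [/memC[d dD wd]|[d dD wd]].
  by exists d => // i y; rewrite mxE permE /= decE wd pg.
apply/memC; exists d => // j.
have [x <-] : exists x, (g \o dec) x = j by exists (invF sinj j); rewrite f_invF.
case/mxvec_indexP: x => i y; rewrite /= decE pg /= -(wd i) mxE permE /= decE //.
Qed.

Lemma F2_eq (a b : 'F_2) : (a != 0) = (b != 0) -> a = b.
Proof.
have [->|/F2_neq0->] := eqVneq a 0; have [->|/F2_neq0->] := eqVneq b 0 => //.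
Qed.

Lemma mulmx_col_eq k n N (G : 'M['F_2]_(k, n)) (H : 'M['F_2]_(k, N)) (u : 'rV_k) j y :
  col j G = col y H -> (u *m G) 0 j = (u *m H) 0 y.
Proof. by move=> e; apply: F2_eq; rewrite -!dot_col e. Qed.

Lemma col_Sim k y : col y (Sim_matrix k) = enum_val y.
Proof. by apply/colP => i; rewrite !mxE. Qed.

Lemma col_RM k y : col y (RM_matrix k.+1) = col_mx (enum_val y) 1.
Proof.
apply/colP => i; rewrite mxE; case: (split_ordP i) => l ->.
  by rewrite !col_mxEu mxE.
by rewrite !col_mxEd !mxE !ord1.
Qed.

Lemma sim_type_iso Delta k n (G : 'M['F_2]_(k, n)) : (0 < k)%N ->
  sim_type Delta G -> (forall j, col j G != 0) ->
  code_iso (generated_code G) (listed_code Delta Simplex k).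
Proof.
move=> k0 [m mD mG] Gn0; rewrite /listed_code.
have mE : (Delta %/ 2 ^ (k - 1) = m)%N.
  have e : (Delta = m * 2 ^ (k - 1))%N.
    by move: mD; rewrite -{1}(subnKC k0) expnD; set N := (2 ^ (k - 1))%N; lia.
  by rewrite e mulnK // expn_gt0.
have Gin j : col j G \in [set v | v != 0] by rewrite inE.
pose p j := enum_rank_in (Gin j) (col j G).
have pE j : enum_val (p j) = col j G by rewrite enum_rankK_in.
apply: (@code_iso_repetition (Delta %/ 2 ^ (k - 1)) n _ (generated_code G) (Sim k) p).
  rewrite mE => y; have := enum_valP y; rewrite inE => /mG <-; apply: eq_card => j.
  by rewrite !inE -(inj_eq enum_val_inj) pE.
have uE (u : 'rV_k) j : (u *m G) 0 j = (u *m Sim_matrix k) 0 (p j).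
  have e : col j G = col (p j) (Sim_matrix k) by rewrite col_Sim pE.
  exact: (mulmx_col_eq u e).
move=> w; split=> [/mem_generated_code[u ->]|[d /mem_generated_code[u ->] wd]].
  by exists (u *m Sim_matrix k) => [|j]; [apply/mem_generated_code; exists u | apply: uE].
by apply/mem_generated_code; exists u; apply/rowP => j; rewrite wd uE.
Qed.

Lemma complete_row k (u : 'rV['F_2]_k.+1) : u != 0 ->
  exists2 W : 'M['F_2]_(k, k.+1), row_free (col_mx W u) & row_full (col_mx W u).
Proof.
move=> u0; have r : \rank (u^C)%MS = k by rewrite mxrank_compl rank_rV u0 subn1.
have [W WE] : exists W : 'M['F_2]_(k, k.+1), (W :=: u^C)%MS.
  exists (castmx (r, erefl) (row_base (u^C)%MS)).
  exact: eqmx_trans (eqmx_cast _ _) (eq_row_base _).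
have rW : \rank (col_mx W u) = k.+1.
  rewrite -addsmxE (adds_eqmx WE (eqmx_refl u)) addsmxC.
  exact/eqP/addsmx_compl_full.
by exists W; rewrite /row_free /row_full rW ?addn1.
Qed.

(** Complete [u0] to a basis as the last row of [A]. All columns of [G] satisfy [u0 = 1], so the
    base change [A] turns them into columns with last entry 1, those of [RM_matrix]. *)
Lemma rm_type_iso Delta k n (G : 'M['F_2]_(k, n)) :
  rm_type Delta G -> (forall j, col j G != 0) ->
  code_iso (generated_code G) (listed_code Delta ReedMuller k).
Proof.
case: k G => [|k] G [m [u0 [k2 u0_0 mD mG]]] Gn0 //; rewrite /listed_code.
have mE : (Delta %/ 2 ^ (k.+1 - 2) = m)%N.
  have e : (Delta = m * 2 ^ (k.+1 - 2))%N.
    by move: mD; rewrite -{1}(subnKC (ltnW k2)) expnD; set N := (2 ^ (k.+1 - 2))%N; lia.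
  by rewrite e mulnK // expn_gt0.
have [W Wfree Wfull] := complete_row u0_0; pose A := col_mx W u0.
have u0G j : dot u0 (col j G).
  have := mG _ (Gn0 j); case: (dot _ _) => //; rewrite muln0 => /eqP.
  by rewrite cards_eq0 => /eqP/setP/(_ j); rewrite !inE eqxx.
pose p j : 'I_#|{: 'cV['F_2]_k}| := enum_rank (W *m col j G).
have Acol x : dot u0 x -> A *m x = col_mx (W *m x) 1.
  by move=> ux; rewrite mul_col_mx (mx11_eq1 (a := u0 *m x)) // mx11_neq0.
(* [A] has [k + 1] rows and [k.+1] columns, which are not convertible, hence the separate right and
   left inverses. *)
have [B AB] := row_freeP Wfree; have [B' BA] := row_fullP Wfull.
have pA j : A *m col j G = col (p j) (RM_matrix k.+1) by rewrite Acol // col_RM enum_rankK.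
have uE (v : 'rV_(k + 1)) j : (v *m (A *m G)) 0 j = (v *m RM_matrix k.+1) 0 (p j).
  have e : col j (A *m G) = col (p j) (RM_matrix k.+1) by rewrite -pA !colE mulmxA.
  exact: (mulmx_col_eq v e).
apply: (@code_iso_repetition (Delta %/ 2 ^ (k.+1 - 2)) n _ (generated_code G) (RM k.+1) p).
  rewrite mE => y; pose x := B *m col_mx (enum_val y : 'cV_k) 1.
  have Ax : A *m x = col_mx (enum_val y) 1 by rewrite mulmxA AB mul1mx.
  have [Wx u0x] : W *m x = enum_val y /\ u0 *m x = 1.
    by move: Ax; rewrite mul_col_mx => /eq_col_mx.
  have ux : dot u0 x by rewrite /dot u0x mxE.
  have x0 : x != 0 by apply: contraTneq ux => ->; rewrite dotx0.
  have := mG x x0; rewrite ux muln1 => <-; apply: eq_card => j; rewrite !inE.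
  rewrite -(inj_eq enum_val_inj) enum_rankK; apply/eqP/eqP => [Wj|-> //].
  rewrite -[LHS]mul1mx -[RHS]mul1mx -BA -!mulmxA Acol // Ax.
  by rewrite Wj.
move=> w; split=> [/mem_generated_code[u ->]|[d /mem_generated_code[v ->] wd]].
  exists (u *m B' *m RM_matrix k.+1); first by apply/mem_generated_code; exists (u *m B').
  by move=> j; rewrite -uE mulmxA -(mulmxA u) BA mulmx1.
by apply/mem_generated_code; exists (v *m A); apply/rowP => j; rewrite wd -mulmxA uE.
Qed.

Lemma pc_type_iso Delta k n (G : 'M['F_2]_(k, n)) : (0 < Delta)%N -> row_free G ->
  pc_type Delta G -> (forall j, col j G != 0) ->
  code_iso (generated_code G) (listed_code Delta ParityCheck k).
Proof.
move=> D0 Gfree [P [k3 cP P0 sP mG]] Gn0; rewrite /listed_code.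
have [q [qinj qP qsurj wq]] := PC_points cP sP (fun u => pc_spanning Gfree mG).
have pex j : exists y, q y == col j G.
  have [|y qy] := qsurj (col j G); last by exists y; apply/eqP.
  have := mG _ (Gn0 j); case: (_ \in P) => //; rewrite muln0 => /eqP.
  by rewrite muln_eq0 /= cards_eq0 => /eqP/setP/(_ j); rewrite !inE eqxx.
pose p j := xchoose (pex j); have pE j : q (p j) = col j G by apply/eqP/(xchooseP (pex j)).
apply: (@code_iso_repetition (Delta %/ 2) n _ (generated_code G) (PC k) p).
  move=> y; have := mG (q y); rewrite qP muln1 => mq.
  have <- : (2 * mult G (q y) = Delta)%N by apply: mq; apply: contraNneq P0 => <-.
  rewrite mulKn //; apply: eq_card => j; rewrite !inE.
  by rewrite -(inj_eq qinj) pE.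
move=> w; split=> [/mem_generated_code[u ->]|[d /wq[u ud] wd]].
  exists (\row_y (dot u (q y))%:R); first by apply/wq; exists u => y; rewrite mxE; case: (dot _ _).
  by move=> j; rewrite [RHS]mxE pE dot_col; apply: F2_eq; case: (_ != 0).
apply/mem_generated_code; exists u; apply/rowP => j; rewrite wd.
by apply: F2_eq; rewrite ud pE dot_col.
Qed.

Lemma classified_code_listed Delta a k n (C : code n) : (0 < Delta)%N ->
  (forall b : nat, 2 ^ b %| Delta -> b <= a)%N -> (0 < k)%N ->
  classified_code Delta k C ->
  exists2 f, in_list a f k & code_iso C (listed_code Delta f k).
Proof.
move=> D0 max_a k0 [dimC indC fullC divC spanC].
have [|G [GC Gfree Gtype]] := exists_typed_generators D0 indC divC spanC (k := k).
  by rewrite k0 dimC /=.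
have CG : C = generated_code G.
  apply/eqP; rewrite eq_sym eqEdim dim_generated_code // dimC leqnn andbT.
  by apply/subvP => _ /mem_generated_code[u ->]; apply: mulmx_mem_code.
have Gn0 j : col j G != 0.
  have [c] := fullC j; rewrite {1}CG => /mem_generated_code[u ->]; rewrite -dot_col.
  by apply: contraTneq => ->; rewrite dotx0.
rewrite CG; case: Gtype => Gt.
- exists Simplex; last exact: sim_type_iso.
  rewrite /in_list k0 /= addn1; case: Gt => m mD _.
  suff : (2 ^ (k - 1) %| Delta)%N by move/max_a; lia.
  apply/dvdnP; exists m; move: mD; rewrite -{1}(subnKC k0) expnD; set N := (2 ^ (k - 1))%N; lia.
- exists ReedMuller; last exact: rm_type_iso.
  case: Gt => m [_ [k2 _ mD _]]; rewrite /in_list k2 /=.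
  suff : (2 ^ (k - 2) %| Delta)%N by move/max_a; lia.
  apply/dvdnP; exists m; move: mD; rewrite -{1}(subnKC (ltnW k2)) expnD; set N := (2 ^ (k - 2))%N; lia.
- exists ParityCheck; last exact: pc_type_iso.
  (* A point of [P] has multiplicity Delta/2, so Delta is even and [a] is at least 1. *)
  case: Gt => P [k3 cP P0 _ mG]; rewrite /in_list k3 andbT; apply: (max_a 1%N).
  have /set0Pn[p pP] : P != set0 by rewrite -card_gt0 cP.
  have := mG p; rewrite pP muln1 expn1 => <-; first exact: dvdn_mulr.
  by apply: contraNneq P0 => <-.
Qed.

(** * Indecomposability of the listed codes *)

(** The last clause stands in for indecomposability: it implies it and is easily carried over to
    repetitions. *)
Definition linked_class Delta k n (C : code n) : Prop :=
  [/\ \dim C = k, full_length C, divisible_code Delta C, spanned_by_weight Delta C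
    & forall c d, c \in C -> d \in C -> weight c = Delta -> weight d = Delta ->
      exists r, [/\ r \in C, weight r = Delta, (0 < overlap c r)%N & (0 < overlap r d)%N]].

Lemma overlapvv n (c : 'rV['F_2]_n) : overlap c c = weight c.
Proof. by apply: eq_card => j; rewrite !inE andbb. Qed.

Lemma spanned_by_weight_seq Delta n (C : code n) (X : seq 'rV['F_2]_n) :
  (forall x, x \in X -> x \in C /\ weight x = Delta) -> (C <= <<X>>)%VS ->
  spanned_by_weight Delta C.
Proof.
move=> XC CX; apply/eqP; rewrite eqEsubv; apply/andP; split.
  by apply/span_subvP => c; rewrite mem_filter => /andP[/andP[]].
apply: subv_trans CX _; apply: sub_span => x /XC[xC wx].
by rewrite mem_filter xC wx eqxx mem_enum ?memvf.
Qed.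

(* In a decomposition D + D', a word of weight Delta lies in D or in D', because
   both of its components have weights divisible by Delta; words that overlap lie
   on the same side. *)
Lemma linked_class_classified Delta k n (C : code n) : (0 < Delta)%N ->
  linked_class Delta k C -> classified_code Delta k C.
Proof.
move=> D0 [dimC fullC divC spanC linkC]; split=> // -[D [D' [Dn0 D'n0 sumD disj]]].
have DC : (D <= C)%VS by rewrite -sumD addvSl.
have D'C : (D' <= C)%VS by rewrite -sumD addvSr.
have ov0 d d' : d \in D -> d' \in D' -> overlap d d' = 0%N.
  move=> dD d'D'; apply/eqP; rewrite cards_eq0; apply/eqP/setP => j; rewrite !inE.
  apply/negP => /andP[dj d'j]; have /pred0P/(_ j) := disj; rewrite /= !inE.
  suff [-> ->] : [exists c, (c \in D) && (c 0 j != 0)] /\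
                 [exists c, (c \in D') && (c 0 j != 0)] by [].
  by split; apply/existsP; [exists d; rewrite dD | exists d'; rewrite d'D'].
have side c : c \in C -> weight c = Delta -> (c \in D) || (c \in D').
  rewrite -sumD => /memv_addP[d dD [d' d'D' ->]] wc.
  have := weightD d d'; rewrite ov0 // wc muln0 addn0 => e.
  have /dvdnP[q qE] := divC _ (subvP DC _ dD); have /dvdnP[q' q'E] := divC _ (subvP D'C _ d'D').
  have [/eqP|/eqP] : weight d = 0%N \/ weight d' = 0%N.
    by move: e; rewrite qE q'E; case: q {qE} => [|q]; case: q' {q'E} => [|q']; lia.
  - by rewrite weight_eq0 => /eqP->; rewrite add0r d'D' orbT.
  - by rewrite weight_eq0 => /eqP->; rewrite addr0 dD.
(* If [E'] contained all words of weight Delta it would contain [C], and a nonzero word of [E] would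
   have overlap 0 with itself. *)
have outside (E E' : code n) : (E <= C)%VS -> E != 0%VS ->
    (forall d d', d \in E -> d' \in E' -> overlap d d' = 0%N) ->
    exists c, [/\ c \in C, weight c = Delta & c \notin E'].
  move=> EC En0 ov; case: (pickP [pred c | [&& c \in C, weight c == Delta & c \notin E']]).
    by move=> c /and3P[cC /eqP wc cE']; exists c.
  move=> none; case/negP: En0; rewrite -subv0; apply/subvP => d dE.
  suff dE' : d \in E' by rewrite memv0 -weight_eq0 -overlapvv ov.
  suff /subvP : (C <= E')%VS by apply; apply: (subvP EC).
  rewrite -spanC; apply/span_subvP => c; rewrite mem_filter => /andP[/andP[cC wc] _].
  by have := none c; rewrite /= cC wc /= => /negbFE.
have [c [cC wc cD']] := outside D D' DC Dn0 ov0.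
have [|d [dC wd dD]] := outside D' D D'C D'n0.
  by move=> x y xD' yD; rewrite -[RHS](ov0 y x) //; apply: eq_card => j; rewrite !inE andbC.
have cD : c \in D by have := side c cC wc; rewrite (negPf cD') orbF.
have dD' : d \in D' by have := side d dC wd; rewrite (negPf dD).
have [r [rC wr cr rd]] := linkC c d cC dC wc wd.
by case/orP: (side r rC wr) => rD; [rewrite ov0 in rd | rewrite ov0 in cr].
Qed.

Lemma card_mxvec m n (Q : pred 'I_(m * n)) (P : pred 'I_n) :
  (forall i j, Q (mxvec_index i j) = P j) ->
  #|[set x | Q x]| = (m * #|[set j | P j]|)%N.
Proof.
move=> QP; rewrite -sum1dep_card big_mkcond (reindex _ (curry_mxvec_bij m n)) /=.
rewrite (eq_bigr (fun p : 'I_m * 'I_n => nat_of_bool (P p.2))) => [|[i j] _]; last first.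
  by rewrite /= QP; case: (P j).
rewrite -(pair_bigA _ (fun _ j => nat_of_bool (P j))) /= sum_nat_const card_ord.
by rewrite -big_mkcond sum1dep_card.
Qed.

Lemma linked_class_repetition Delta m k n (C : code n) : (0 < m)%N ->
  linked_class Delta k C -> linked_class (m * Delta) k (repetition m C).
Proof.
move=> m0 [dimC fullC divC spanC linkC].
pose rho := linfun (mxvec \o mulmx (const_mx 1 : 'cV['F_2]_m) : 'rV_n -> 'rV_(m * n)).
have rhoE c i j : rho c 0 (mxvec_index i j) = c 0 j.
  by rewrite lfunE /= mxvecE mxE big_ord1 !mxE mul1r.
have wrho c : weight (rho c) = (m * weight c)%N.
  by apply: (card_mxvec (P := fun j => c 0 j != 0)) => i j; rewrite rhoE.
have orho c d : overlap (rho c) (rho d) = (m * overlap c d)%N.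
  by apply: (card_mxvec (P := fun j => (c 0 j != 0) && (d 0 j != 0))) => i j; rewrite !rhoE.
have repE v : v \in repetition m C -> exists2 c, c \in C & v = rho c.
  by case/memv_imgP=> c cC ->; exists c.
have rhoC c : c \in C -> rho c \in repetition m C by move=> cC; apply: memv_img.
split.
- rewrite -dimC; apply: limg_dim_eq; apply/eqP; rewrite -subv0; apply/subvP => c.
  rewrite memv_cap memv_ker memv0 => /andP[_ /eqP c0]; apply/eqP/rowP => j.
  by rewrite -(rhoE c (Ordinal m0)) [rho c]c0 !mxE.
- move=> x; case/mxvec_indexP: x => i j; have [c cC cj] := fullC j.
  by exists (rho c); rewrite ?rhoC ?rhoE.
- by move=> v /repE[c /divC cC ->]; rewrite wrho dvdn_pmul2l.
- pose X := [seq c <- enum {: 'rV['F_2]_n} | (c \in C) && (weight c == Delta)].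
  apply: (@spanned_by_weight_seq _ _ _ (map rho X)).
    move=> _ /mapP[c cX ->]; move: cX; rewrite mem_filter => /andP[/andP[cC /eqP wc] _].
    by rewrite rhoC // wrho wc.
  by rewrite -limg_span; apply: limgS; rewrite -{1}spanC; apply: sub_span => c;
    rewrite mem_filter => /andP[h _]; rewrite mem_filter h mem_enum ?memvf.
- move=> _ _ /repE[c cC ->] /repE[d dC ->]; rewrite !wrho => /eqP; rewrite eqn_pmul2l // => /eqP wc.
  move/eqP; rewrite eqn_pmul2l // => /eqP wd; have [r [rC wr cr rd]] := linkC c d cC dC wc wd.
  by exists (rho r); rewrite rhoC // wrho wr !orho !muln_gt0 m0.
Qed.

Lemma full_length_generated k n (G : 'M['F_2]_(k, n)) :
  (forall j, col j G != 0) -> full_length (generated_code G).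
Proof.
move=> Gn0 j; have [u uj] := dot_separate_zero (Gn0 j); exists (u *m G).
  by apply/mem_generated_code; exists u.
by rewrite -dot_col.
Qed.

Lemma row_free_weight k n (G : 'M['F_2]_(k, n)) :
  (forall u, u != 0 -> (0 < weight (u *m G))%N) -> row_free G.
Proof.
move=> wG; apply: inj_row_free => u uG; apply: contraTeq isT => /wG.
by rewrite lt0n weight_eq0 uG eqxx.
Qed.

Lemma overlap_gt0 Delta n (c d : 'rV['F_2]_n) : (0 < Delta)%N ->
  weight c = Delta -> weight d = Delta -> weight (c + d) = Delta -> (0 < overlap c d)%N.
Proof. by move=> D0 wc wd wcd; have := weightD c d; lia. Qed.

(** All nonzero words have weight Delta, so any two of them overlap and [c] itself is the link. *)
Lemma sim_type_linked Delta k n (G : 'M['F_2]_(k, n)) : (0 < Delta)%N ->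
  sim_type Delta G -> (forall j, col j G != 0) ->
  linked_class Delta k (generated_code G).
Proof.
move=> D0 Gt Gn0; have wG u := sim_type_weight (u := u) Gt.
have Gfree : row_free G by apply: row_free_weight => u /wG ->.
split; [exact: dim_generated_code|exact: full_length_generated| | |].
- move=> _ /mem_generated_code[u ->]; have [->|/wG->//] := eqVneq u 0.
  by rewrite mul0mx (_ : weight 0 = 0%N) ?dvdn0 //; apply/eqP; rewrite weight_eq0.
- apply: spanned_by_weight_seq (subvv _) => _ /mapP[i _ ->]; rewrite rowE; split.
    by apply/mem_generated_code; exists (delta_mx 0 i).
  by apply: wG; apply/eqP => /matrixP/(_ 0 i); rewrite !mxE !eqxx.
move=> _ _ /mem_generated_code[u ->] /mem_generated_code[v ->] wu wv.
exists (u *m G); split=> //; first by apply/mem_generated_code; exists u.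
  by rewrite overlapvv wu.
have [->|uv] := eqVneq u v; first by rewrite overlapvv wv.
by apply: overlap_gt0 wu wv _ => //; rewrite -mulmxDl wG // F2_addv_eq0.
Qed.

(** Apart from 0 and the word of [u0], all words have weight Delta, and two such words overlap
    unless their functionals differ by [u0]. A linking [t] must avoid only four of at least eight
    functionals. *)
Lemma rm_type_linked Delta k n (G : 'M['F_2]_(k, n)) : (0 < Delta)%N ->
  rm_type Delta G -> (forall j, col j G != 0) ->
  linked_class Delta k (generated_code G).
Proof.
move=> D0 [m [u0 [k2 u0_0 mD mG]]] Gn0.
have wG u := rm_type_weight (u := u) mD u0_0 mG.
have wu0 : weight (u0 *m G) = (2 * Delta)%N.
  rewrite weight_mulmx (eq_bigr (fun=> m)) => [|x ux]; last first.
    by rewrite mG ?ux ?muln1 //; apply: contraTneq ux => ->; rewrite dotx0.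
  by have := sum_dot_col m u0_0; lia.
have w0 : weight (0 : 'rV['F_2]_n) = 0%N by apply/eqP; rewrite weight_eq0.
have Gfree : row_free G.
  by apply: row_free_weight => u u_0; have [->|uu0] := eqVneq u u0; rewrite ?wu0 ?wG ?muln_gt0.
have memG u : u *m G \in generated_code G by apply/mem_generated_code; exists u.
have k8 : (8 <= #|{: 'rV['F_2]_k}|)%N by rewrite card_rV2 (@leq_exp2l 2 3).
split; [exact: dim_generated_code|exact: full_length_generated| | |].
- move=> _ /mem_generated_code[u ->]; have [->|u_0] := eqVneq u 0.
    by rewrite mul0mx w0.
  by have [->|/wG->//] := eqVneq u u0; rewrite wu0 dvdn_mull.
- pose X := [seq u *m G | u <- enum 'rV['F_2]_k & (u != 0) && (u != u0)].
  have XE u : u != 0 -> u != u0 -> u *m G \in <<X>>%VS.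
    move=> u_0 uu0; apply: memv_span; apply: map_f.
    by rewrite mem_filter u_0 uu0 mem_enum.
  apply: (@spanned_by_weight_seq _ _ _ X).
    move=> _ /mapP[u uX ->]; move: uX; rewrite mem_filter => /andP[/andP[u_0 uu0] _].
    by rewrite wG.
  apply/subvP => _ /mem_generated_code[u ->]; have [->|u_0] := eqVneq u 0.
    by rewrite mul0mx mem0v.
  have [->|] := eqVneq u u0; last exact: XE.
  have [|v] := @exists_notin _ [set 0; u0].
    by apply: leq_ltn_trans k8; rewrite cards2; case: (_ != _).
  rewrite !inE negb_or => /andP[v_0 vu0].
  (* The word of [u0] has weight 2 Delta, so it is written as a sum of two words of weight Delta. *)
  have -> : u0 = v + (v + u0) by rewrite addrA F2_addvv add0r.
  rewrite mulmxDl memvD ?XE //; first by rewrite F2_addv_eq0.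
  by rewrite -subr_eq0 addrK.
move=> _ _ /mem_generated_code[u ->] /mem_generated_code[v ->] wu wv.
have nz w : weight (w *m G) = Delta -> w != 0 /\ w != u0.
  move=> ww; split; apply/eqP => e; move: ww; rewrite e ?mul0mx ?w0 ?wu0; lia.
have [t] : exists t, t \notin [set 0; u0; u + u0; v + u0].
  have c3 : (#|[set 0%R; u0; u + u0]%R| <= 3)%N.
    by apply: leq_trans (leq_card_setU _ _) _; rewrite cards1 cards2; case: (_ != _).
  apply: exists_notin; apply: leq_ltn_trans (leq_card_setU _ _) _.
  by rewrite cards1 addn1; apply: leq_trans k8; rewrite !ltnS (leq_trans c3).
rewrite !inE !negb_or -!andbA => /and4P[t_0 tu0 tu tv].
have ov w : weight (w *m G) = Delta -> t != w + u0 -> (0 < overlap (w *m G) (t *m G))%N.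
  move=> ww twu0; have [->|wt] := eqVneq w t; first by rewrite overlapvv wG.
  apply: (overlap_gt0 D0 ww); rewrite ?wG //.
  rewrite -mulmxDl wG ?F2_addv_eq0 //; apply: contraNneq twu0 => <-.
  by rewrite addrA F2_addvv add0r.
exists (t *m G); split; rewrite ?wG ?ov //.
by rewrite (_ : overlap _ _ = overlap (v *m G) (t *m G)) ?ov //; apply: eq_card => j; rewrite !inE andbC.
Qed.

Lemma sum_weight n (c : 'rV['F_2]_n) : \sum_j c 0 j = (weight c)%:R.
Proof.
rewrite /weight -sum1_card natr_sum [RHS]big_mkcond; apply: eq_bigr => j _.
by rewrite inE; case: eqVneq => [->|/F2_neq0].
Qed.

Lemma mem_PC_even k (c : 'rV_k.+1) : (c \in PC k) = ~~ odd (weight c).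
Proof.
rewrite mem_PC sum_weight -dvdn2; apply/eqP/idP => [/eqP|/dvdnP[q ->]].
  by rewrite -(dvdn_pcharf (p := 2)) // pchar_Fp.
by rewrite natrM (_ : 2%:R = 0) ?mulr0 //; apply: val_inj.
Qed.

Lemma pair_word n (i j l : 'I_n) : i != j ->
  ((delta_mx 0 i + delta_mx 0 j : 'rV['F_2]_n) 0 l != 0) = (l \in [set i; j]).
Proof.
move=> ij; rewrite !mxE !inE /=; have [->|li] := eqVneq l i; first by rewrite (negPf ij).
by case: (l == j).
Qed.

Lemma weight_pair n (i j : 'I_n) : i != j ->
  weight (delta_mx 0 i + delta_mx 0 j : 'rV['F_2]_n) = 2%N.
Proof.
move=> ij; have e := cards2 i j; rewrite ij in e; rewrite -[RHS]e.
by apply: eq_card => l; rewrite inE pair_word.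
Qed.

(** The words of weight 2 are the pairs of coordinates; a pair containing [i] and a pair containing
    [j] are linked by the pair of [i] and [j]. *)
Lemma PC_linked k : (0 < k)%N -> linked_class 2 k (PC k).
Proof.
move=> k0; pose M : 'M['F_2]_(k, k.+1) := \matrix_i (delta_mx 0 ord0 + delta_mx 0 (lift ord0 i)).
have Mrow i : row i M = delta_mx 0 ord0 + delta_mx 0 (lift ord0 i) by rewrite rowK.
have Mfree : row_free M.
  apply: inj_row_free => u /rowP uM; apply/rowP => i; have := uM (lift ord0 i).
  rewrite !mxE (bigD1 i) //= big1 => [|l li].
    by rewrite !mxE /= eqxx /= add0r mulr1 addr0.
  by rewrite !mxE /= (inj_eq lift_inj) eq_sym (negPf li) /= addr0 mulr0.
have wpair i j : i != j -> delta_mx 0 i + delta_mx 0 j \in PC k.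
  by move=> ij; rewrite mem_PC_even weight_pair.
have M0 i : \sum_j M i j = 0.
  have := wpair _ _ (neq_lift ord0 i); rewrite mem_PC -Mrow => /eqP e; rewrite -[RHS]e.
  by apply: eq_bigr => j _; rewrite [RHS]mxE.
have PCM : PC k = generated_code M.
  apply/vspaceP => w; rewrite (mem_PC_row_free w Mfree M0).
  by apply/submxP/mem_generated_code.
split.
- by rewrite PCM dim_generated_code.
- move=> j; have [|i] := @exists_notin _ [set j]; first by rewrite cards1 card_ord ltnS.
  rewrite inE => ij; exists (delta_mx 0 i + delta_mx 0 j); first exact: wpair.
  by rewrite pair_word // !inE eqxx orbT.
- by move=> c; rewrite mem_PC_even dvdn2.
- apply: (@spanned_by_weight_seq _ _ _ [seq row i M | i <- enum 'I_k]).
    by move=> _ /mapP[i _ ->]; rewrite Mrow wpair ?weight_pair ?neq_lift.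
  by rewrite {1}PCM subvv.
move=> c d cC dC wc wd.
have nz (w : 'rV_k.+1) : weight w = 2%N -> exists i, w 0 i != 0.
  move=> ww; have /card_gt0P[i] : (0 < weight w)%N by rewrite ww.
  by rewrite inE; exists i.
have [i ci] := nz c wc; have [j dj] := nz d wd.
have [ij|ij] := eqVneq i j.
  exists c; rewrite overlapvv wc; split=> //; apply/card_gt0P; exists i.
  by rewrite inE ci ij dj.
exists (delta_mx 0 i + delta_mx 0 j); rewrite wpair // weight_pair //; split=> //.
  by apply/card_gt0P; exists i; rewrite inE ci pair_word // !inE eqxx.
by apply/card_gt0P; exists j; rewrite inE dj pair_word // !inE eqxx orbT.
Qed.

(** Each nonzero column occurs once, so this is the case [m = 1] of the simplex type. *)
Lemma Sim_linked k : (0 < k)%N -> linked_class (2 ^ (k - 1)) k (Sim k).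
Proof.
move=> k0; apply: sim_type_linked; first by rewrite expn_gt0.
  exists 1%N; first by rewrite mul1n -expnS subn1 prednK.
  move=> x x0; have xin : x \in [set v | v != 0] by rewrite inE.
  rewrite /mult -[RHS](cards1 (enum_rank_in xin x)); apply: eq_card => j; rewrite !inE.
  by rewrite col_Sim -(inj_eq enum_val_inj) enum_rankK_in.
by move=> y; rewrite col_Sim; have := enum_valP y; rewrite inE.
Qed.

Lemma RM_linked k : (2 < k)%N -> linked_class (2 ^ (k - 2)) k (RM k).
Proof.
case: k => // k k2; rewrite -[in X in linked_class _ X _]addn1.
have dotu (y : 'cV['F_2]_k) (b : 'M_1) : dot (row_mx 0 1) (col_mx y b) = (b != 0).
  by rewrite /dot mul_row_col mul0mx mul1mx add0r mx11_neq0.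
apply: rm_type_linked; first by rewrite expn_gt0.
  (* The functional [row_mx 0 1] reads off the all-one row. *)
  exists 1%N, (row_mx 0 1); split.
  - by rewrite addn1.
  - by rewrite row_mx_eq0 oner_eq0 andbF.
  - by rewrite mul1n addn1 -(expnD 2 2) subnKC // ltnW.
  move=> x _; rewrite -[x]vsubmxK dotu mul1n; set y := usubmx x; set b := dsubmx x.
  have [->|/mx11_eq1->] := eqVneq b 0.
    apply/eqP; rewrite cards_eq0; apply/eqP/setP => j; rewrite !inE col_RM.
    by apply/eqP => /eq_col_mx[_ /eqP]; rewrite oner_eq0.
  rewrite /mult -[RHS](cards1 (enum_rank y)); apply: eq_card => j; rewrite !inE col_RM.
  rewrite -(inj_eq enum_val_inj) enum_rankK.
  by apply/eqP/eqP => [/eq_col_mx[]|->].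
by move=> y; rewrite col_RM col_mx_eq0 oner_eq0 andbF.
Qed.

Lemma listed_code_classified Delta a f k : (0 < Delta)%N -> (2 ^ a %| Delta)%N ->
  in_list a f k -> (1 <= k)%N /\ classified_code Delta k (listed_code Delta f k).
Proof.
move=> D0 dvd_a fk; have dvd b : (b <= a)%N -> (2 ^ b %| Delta)%N.
  by move=> ba; apply: dvdn_trans dvd_a; apply: dvdn_exp2l.
have q0 d : (d %| Delta)%N -> (0 < Delta %/ d)%N.
  by move=> dD; move: D0; rewrite -{1}(divnK dD) muln_gt0 => /andP[].
have k1 : (1 <= k)%N by case: f fk => /=; lia.
split=> //; apply: linked_class_classified => //; case: f fk => /= fk.
- have dD : (2 ^ (k - 1) %| Delta)%N by apply: dvd; lia.
  rewrite -{1}(divnK dD); apply: linked_class_repetition (Sim_linked k1).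
  exact: q0.
- have dD : (2 ^ (k - 2) %| Delta)%N by apply: dvd; lia.
  have k2 : (2 < k)%N by lia.
  rewrite -{1}(divnK dD); apply: linked_class_repetition (RM_linked k2).
  exact: q0.
- have dD : (2 %| Delta)%N by apply: (dvd 1%N); lia.
  rewrite -{1}(divnK dD); apply: linked_class_repetition (PC_linked k1).
  exact: q0.
Qed.

(** * Telling the listed codes apart *)

Lemma code_iso_dim n m (C : code n) (D : code m) : code_iso C D -> \dim C = \dim D.
Proof.
case=> e; subst m => -[s sE].
pose g := linfun (col_perm s : 'rV['F_2]_n -> 'rV['F_2]_n).
have gE c : g c = col_perm s c by rewrite lfunE.
have -> : D = (g @: C)%VS.
  apply/vspaceP => d; apply/idP/memv_imgP => [dD|[c cC ->]]; last first.
    by rewrite gE; have := sE c; rewrite castmx_id cC => <-.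
  exists (col_perm s^-1 d); last by rewrite gE -col_permM mulgV col_perm1.
  by rewrite sE castmx_id -col_permM mulgV col_perm1.
symmetry; apply: limg_dim_eq; apply/eqP; rewrite -subv0; apply/subvP => c.
rewrite memv_cap memv_ker memv0 gE => /andP[_ /eqP c0]; apply/eqP.
by rewrite -[c](col_perm1) -(mulVg s) col_permM c0 col_perm_const.
Qed.

(** The lengths are 2 Delta - Delta / 2^(k-1), 2 Delta and (k+1) Delta / 2. The last exceeds 2 Delta
    because [k] is at least 4. *)
Lemma listed_length_cmp Delta a f k : (0 < Delta)%N -> (2 ^ a %| Delta)%N -> in_list a f k ->
  match f with
  | Simplex => (listed_length Delta f k < 2 * Delta)%N
  | ReedMuller => (listed_length Delta f k == 2 * Delta)%N
  | ParityCheck => (2 * Delta < listed_length Delta f k)%N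
  end.
Proof.
move=> D0 dvd_a fk; have dvd b : (b <= a)%N -> (2 ^ b %| Delta)%N.
  by move=> ba; apply: dvdn_trans dvd_a; apply: dvdn_exp2l.
case: f fk => /= fk.
- have dD : (2 ^ (k - 1) %| Delta)%N by apply: dvd; lia.
  have := card_neq0_cV k; rewrite (_ : #|[pred x | _]| = #|[set v : 'cV['F_2]_k | v != 0]|); last first.
    by apply: eq_card => x; rewrite !inE.
  have -> : (2 ^ k = 2 * 2 ^ (k - 1))%N by rewrite -expnS subn1 prednK //; lia.
  move: #|_| => N; have := divnK dD; move: (2 ^ (k - 1))%N (Delta %/ _)%N => p q; nia.
- have dD : (2 ^ (k - 2) %| Delta)%N by apply: dvd; lia.
  rewrite card_cV2; have -> : (2 ^ k.-1 = 2 * 2 ^ (k - 2))%N.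
    by rewrite -expnS; congr (2 ^ _)%N; lia.
  have := divnK dD; move: (2 ^ (k - 2))%N (Delta %/ _)%N => p q; nia.
- have dD : (2 %| Delta)%N by apply: (dvd 1%N); lia.
  have := divnK dD; move: (Delta %/ _)%N => q; nia.
Qed.

End Classification.

Theorem theorem3 (Delta a : nat) (Delta_gt0 : 0 < Delta)
    (dvd_a : 2 ^ a %| Delta) (max_a : forall b : nat, 2 ^ b %| Delta -> b <= a) :
  [/\ (* every listed code is in the class *)
      forall (f : code_family) (k : nat), in_list a f k ->
        1 <= k /\ classified_code Delta k (listed_code Delta f k),
      (* complete *)
      forall (k n : nat) (C : code n), 1 <= k -> classified_code Delta k C ->
        exists2 f : code_family, in_list a f k & code_iso C (listed_code Delta f k)
    & (* non-redundant *)
      forall (f f' : code_family) (k k' : nat), in_list a f k -> in_list a f' k' ->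
        code_iso (listed_code Delta f k) (listed_code Delta f' k') ->
        f = f' /\ k = k'].
Proof.
split.
- by move=> f k; apply: listed_code_classified.
- by move=> k n C; apply: classified_code_listed.
move=> f f' k k' fk fk' iso.
have [_ [dimk _ _ _ _]] := listed_code_classified Delta_gt0 dvd_a fk.
have [_ [dimk' _ _ _ _]] := listed_code_classified Delta_gt0 dvd_a fk'.
have kk' : k = k' by rewrite -dimk -dimk'; apply: code_iso_dim.
(* An isomorphism includes an equality of lengths, which can hold only within one family. *)
split=> //; have [len _] := iso.
have := listed_length_cmp Delta_gt0 dvd_a fk; have := listed_length_cmp Delta_gt0 dvd_a fk'.
rewrite len; case: f {fk iso dimk len}; case: f' {fk' dimk'} => //; lia.
Qed.
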